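(* In the two-group Gaussian DAG model with priors described in the context, for each node $j\in\{2,\dots,q\}$ the posterior distribution of the shared conditional variance $\sigma_j^2$ (with the coefficient vectors integrated out) is $$\sigma_j^2\mid\boldsymbol{X}^{(1)},\boldsymbol{X}^{(2)},\mathcal{D}^{(1)},\mathcal{D}^{(2)}\ \sim\ \mathrm{I\text{-}Ga}\left(\frac{\alpha^{(1)}}{2}+\frac{\alpha^{(2)}}{2},\ \frac{\beta^{(1)}}{2}+\frac{\beta^{(2)}}{2}\right),$$ where, for $k\in\{1,2\}$, $$\alpha^{(k)}=a_j^{(k)}+n_k,\qquad \beta^{(k)}=g_k+\boldsymbol{X}_j^{(k)\prime}\boldsymbol{X}_j^{(k)}-\hat{\boldsymbol{L}}_j^{(k)\prime}\bar{\boldsymbol{T}}_j^{(k)}\hat{\boldsymbol{L}}_j^{(k)},$$ with $\bar{\boldsymbol{T}}_j^{(k)}=g_k\boldsymbol{I}_{|\mathrm{pa}^{(k)}(j)|}+\boldsymbol{X}^{(k)\prime}_{\mathrm{pa}(j)}\boldsymbol{X}^{(k)}_{\mathrm{pa}(j)}$ and $\hat{\boldsymbol{L}}_j^{(k)}=\big(\bar{\boldsymbol{T}}_j^{(k)}\big)^{-1}\boldsymbol{X}^{(k)\prime}_{\mathrm{pa}(j)}\boldsymbol{X}_j^{(k)}$.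
   Context: For $k=1,2$: $\mathcal{D}^{(k)}$ is a given DAG on $V=\{1,\dots,q\}$, $\mathrm{pa}^{(k)}(j)$ is the parent set of $j$ in $\mathcal{D}^{(k)}$, $\boldsymbol{X}^{(k)}$ is a real $n_k\times q$ matrix with columns $\boldsymbol{X}^{(k)}_1,\dots,\boldsymbol{X}^{(k)}_q$, and $\boldsymbol{X}^{(k)}_{\mathrm{pa}(j)}$ is the submatrix of columns indexed by $\mathrm{pa}^{(k)}(j)$. A prime denotes transpose. If $\mathrm{pa}^{(k)}(j)=\emptyset$, the quadratic form $\hat{\boldsymbol{L}}_j^{(k)\prime}\bar{\boldsymbol{T}}_j^{(k)}\hat{\boldsymbol{L}}_j^{(k)}$ is $0$. Parameters: $\sigma_1^2=1$ fixed; $\sigma_j^2>0$ for $j\ge2$, shared by both groups; and $\boldsymbol{L}_j^{(k)}\in\mathbb{R}^{|\mathrm{pa}^{(k)}(j)|}$. Likelihood: $$f(\boldsymbol{X}^{(1)},\boldsymbol{X}^{(2)}\mid\sigma^2,\boldsymbol{L}^{(1)},\boldsymbol{L}^{(2)})=\prod_{k=1}^2\prod_{j=1}^q f_{\mathcal{N}_{n_k}}\big(\boldsymbol{X}_j^{(k)}\mid-\boldsymbol{X}^{(k)}_{\mathrm{pa}(j)}\boldsymbol{L}_j^{(k)},\ \sigma_j^2\boldsymbol{I}_{n_k}\big),$$ with $f_{\mathcal{N}_n}(\cdot\mid\boldsymbol\mu,\boldsymbol\Sigma)$ the $n$-variate normal density. Priors (independent over $j$; given $\sigma_j^2$, independent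 over $k$), with hyperparameters $g_1,g_2>0$, $a>q-1$: for $j\ge2$, $\sigma_j^2\sim\mathrm{I\text{-}Ga}\big(\tfrac{a_j^{(1)}+a_j^{(2)}}{2},\tfrac{g_1+g_2}{2}\big)$, where $a_j^{(k)}=a+|\mathrm{pa}^{(k)}(j)|-q+1$; and for all $j$, $\boldsymbol{L}_j^{(k)}\mid\sigma_j^2\sim\mathcal{N}_{|\mathrm{pa}^{(k)}(j)|}\big(\boldsymbol0,\ g_k^{-1}\sigma_j^2\boldsymbol{I}\big)$. Here $\mathrm{I\text{-}Ga}(\alpha,\beta)$ is the inverse gamma distribution with shape $\alpha$ and rate $\beta$, with density proportional to $x^{-\alpha-1}e^{-\beta/x}$ on $x>0$. *)

(* Defs.v *)
From HB Require Import structures.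
From mathcomp Require Import all_boot all_order all_algebra.
From mathcomp Require Import all_classical all_reals all_analysis.

Set Implicit Arguments.
Unset Strict Implicit.
Unset Printing Implicit Defensive.

Import Order.TTheory GRing.Theory Num.Theory.
Import numFieldNormedType.Exports.

Local Open Scope classical_set_scope.
Local Open Scope ring_scope.

(* R^n is represented by [n.-tuple R], which carries the product
   sigma-algebra; the measure is built by pushing the product of the measures
   on R and R^n forward along [(x, t) |-> x :: t]. *)

Section lebesgue_cons.
Context (R : realType) (n : nat).
Variable m : {sigma_finite_measure set (n.-tuple R) -> \bar R}.

Let cons_pair (xt : measurableTypeR R * n.-tuple R) : n.+1.-tuple R :=
  [tuple of xt.1 :: xt.2].

Let uncons (t : n.+1.-tuple R) : measurableTypeR R * n.-tuple R :=
  (thead t, [tuple of behead t]).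

Let measurable_cons_pair : measurable_fun setT cons_pair.
Proof.
by apply: measurable_cons; [exact: measurable_fst|exact: measurable_snd].
Qed.

Let measurable_uncons : measurable_fun setT uncons.
Proof.
apply: measurable_fun_pair.
- exact: measurable_tnth.
- exact: measurable_behead.
Qed.

Let cons_pairK : cancel cons_pair uncons.
Proof.
by move=> [x t]; rewrite /uncons /cons_pair /=; congr pair; exact: val_inj.
Qed.

Definition lebesgue_cons : set (n.+1.-tuple R) -> \bar R :=
  pushforward (lebesgue_measure \x m)%E
    (fun xt : measurableTypeR R * n.-tuple R => [tuple of xt.1 :: xt.2]).

Let lebesgue_cons0 : lebesgue_cons set0 = 0%E.
Proof. by rewrite /lebesgue_cons /pushforward preimage_set0 measure0. Qed.

Let lebesgue_cons_ge0 A : (0 <= lebesgue_cons A)%E.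
Proof. exact: measure_ge0. Qed.

Let lebesgue_cons_sigma_additive : semi_sigma_additive lebesgue_cons.
Proof.
move=> F mF tF mUF; rewrite /lebesgue_cons /pushforward preimage_bigcup.
apply: measure_semi_sigma_additive.
- by move=> i; rewrite -[X in measurable X]setTI; exact: measurable_cons_pair.
- apply/trivIsetP => /= i j _ _ ij; rewrite -preimage_setI.
  by move/trivIsetP : tF => /(_ _ _ _ _ ij) ->//; rewrite preimage_set0.
- rewrite -preimage_bigcup -[X in measurable X]setTI.
  exact: measurable_cons_pair.
Qed.

HB.instance Definition _ := isMeasure.Build _ _ _ lebesgue_cons
  lebesgue_cons0 lebesgue_cons_ge0 lebesgue_cons_sigma_additive.

Let lebesgue_cons_sigma_finite : sigma_finite setT lebesgue_cons.
Proof.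
have /sigma_finiteP[F [TF ndF Foo]] :=
  sigma_finiteT (@lebesgue_measure R : {sigma_finite_measure set _ -> \bar R}).
have /sigma_finiteP[G [TG ndG Goo]] := sigma_finiteT m.
exists (fun i => uncons @^-1` (F i `*` G i)).
  apply/seteqP; split => // t _.
  have [i _ Fi] : (\bigcup_i F i) (uncons t).1 by rewrite -TF.
  have [j _ Gj] : (\bigcup_i G i) (uncons t).2 by rewrite -TG.
  exists (maxn i j) => //; split.
  - by move: Fi; exact/subsetPset/ndF/leq_maxl.
  - by move: Gj; exact/subsetPset/ndG/leq_maxr.
move=> i; have [mF Fioo] := Foo i; have [mG Gioo] := Goo i.
have mFG : measurable (F i `*` G i : set (measurableTypeR R * n.-tuple R)%type).
  exact: measurableX.
split; first by rewrite -[X in measurable X]setTI; exact: measurable_uncons.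
rewrite /lebesgue_cons /pushforward -comp_preimage.
rewrite (_ : uncons \o _ = id) ?preimage_id; last first.
  by apply/funext => x; exact: cons_pairK.
by rewrite product_measure1E// lte_mul_pinfty// ge0_fin_numE.
Qed.

HB.instance Definition _ := Measure_isSigmaFinite.Build _ _ _ lebesgue_cons
  lebesgue_cons_sigma_finite.

End lebesgue_cons.

Fixpoint lebesgue_tuple (R : realType) (n : nat) :
    {sigma_finite_measure set (n.-tuple R) -> \bar R} :=
  match n with
  | 0 => \d_[tuple]
  | n'.+1 => lebesgue_cons (lebesgue_tuple R n')
  end.

Definition col_of_tuple (R : realType) (n : nat) (t : n.-tuple R) : 'cV[R]_n :=
  \col_i tnth t i.

Definition mvnormal_pdf (R : realType) (n : nat)
    (mu : 'cV[R]_n) (Sigma : 'M[R]_n) (x : 'cV[R]_n) : R :=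
  expR (- ((x - mu)^T *m invmx Sigma *m (x - mu)) 0 0 / 2) /
  Num.sqrt ((2 * pi) ^+ n * \det Sigma).

Definition mvnormal (R : realType) (n : nat)
    (mu : 'cV[R]_n) (Sigma : 'M[R]_n) (B : set (n.-tuple R)) : \bar R :=
  \int[lebesgue_tuple R n]_(t in B) (mvnormal_pdf mu Sigma (col_of_tuple t))%:E.

Definition inv_gamma_fun (R : realType) (alpha beta x : R) : R :=
  x `^ (- alpha - 1) * expR (- beta / x).

Definition inv_gamma (R : realType) (alpha beta : R) (A : set R) : \bar R :=
  ((\int[lebesgue_measure]_(x in A `&` `]0%R, +oo[)
      (inv_gamma_fun alpha beta x)%:E) /
   (\int[lebesgue_measure]_(x in `]0%R, +oo[)
      (inv_gamma_fun alpha beta x)%:E))%E.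

(* Taking [B i = setT] for some of the [i] gives the product rule for every
   subfamily. *)
Definition mutually_independent (d : measure_display) (T : measurableType d)
    (R : realType) (P : probability T R) (I : finType)
    (dS : I -> measure_display) (S : forall i, measurableType (dS i))
    (Y : forall i, {RV P >-> S i}) : Prop :=
  forall B : forall i, set (S i), (forall i, measurable (B i)) ->
    P (\bigcap_i (Y i @^-1` B i)) = (\prod_(i : I) P (Y i @^-1` B i))%E.

(* Bayes' formula: the law of [Y] when the prior probability [P] is reweighted
   by the likelihood [lik].  If the evidence is [0] or [+oo] the result is the
   zero measure, so that an equality with a probability distribution includes
   the fact that the posterior is well defined. *)
Definition posterior (d d' : measure_display) (T : measurableType d)
    (S : measurableType d') (R : realType) (P : probability T R)
    (lik : T -> R) (Y : T -> S) (A : set S) : \bar R :=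
  ((\int[P]_(w in Y @^-1` A) (lik w)%:E) / (\int[P]_w (lik w)%:E))%E.

(* [e i j] is the edge i -> j. *)
Definition is_dag (q : nat) (e : rel 'I_q) : Prop :=
  forall i j, e i j -> ~~ connect e j i.

Definition pa (q : nat) (e : rel 'I_q) (j : 'I_q) : {set 'I_q} :=
  [set i | e i j]%SET.

Definition pa_cols (R : realType) (q n : nat) (e : rel 'I_q) (X : 'M[R]_(n, q))
    (j : 'I_q) : 'M[R]_(n, #|pa e j|) :=
  colsub (fun l : 'I_#|pa e j| => enum_val l) X.

(* Groups are indexed by ['I_2] and nodes by ['I_q]: the node 1, whose variance
   is fixed to 1, is the ordinal of value 0. *)

Definition prior_shape (R : realType) (q : nat) (a : R) (D : 'I_2 -> rel 'I_q)
    (k : 'I_2) (j : 'I_q) : R :=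
  a + #|pa (D k) j|%:R - q%:R + 1.

Definition likelihood (R : realType) (q : nat) (D : 'I_2 -> rel 'I_q)
    (n : 'I_2 -> nat) (X : forall k, 'M[R]_(n k, q))
    (sigma2 : 'I_q -> R)
    (L : forall (k : 'I_2) (j : 'I_q), #|pa (D k) j|.-tuple R) : R :=
  \prod_(k < 2) \prod_(j < q)
    mvnormal_pdf (- (pa_cols (D k) (X k) j *m col_of_tuple (L k j)))
      (sigma2 j)%:M (col j (X k)).

Section prior.
Context (R : realType) (q : nat) (D : 'I_2 -> rel 'I_q).
Context (d : measure_display) (T : measurableType d) (P : probability T R).
Variable sigma2 : 'I_q -> {RV P >-> R}.
Variable L : forall (k : 'I_2) (j : 'I_q), {RV P >-> #|pa (D k) j|.-tuple R}.

Definition node_block (j : 'I_q) (w : T) :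
    R * #|pa (D 0) j|.-tuple R * #|pa (D 1) j|.-tuple R :=
  (sigma2 j w, L 0 j w, L 1 j w).

Let measurable_node_block j : measurable_fun setT (node_block j).
Proof. by do 2?apply: measurable_fun_pair. Qed.

HB.instance Definition _ j :=
  isMeasurableFun.Build _ _ _ _ (node_block j) (@measurable_node_block j).

Record is_prior (a : R) (g : 'I_2 -> R) : Prop := {
  prior_independent : mutually_independent (fun j => node_block j : {RV P >-> _});
  prior_sigma2_first : forall (j : 'I_q) (w : T), j = 0%N :> nat -> sigma2 j w = 1;
  prior_sigma2 : forall (j : 'I_q) (A : set R), (0 < j)%N -> measurable A ->
    distribution P (sigma2 j) A =
    inv_gamma ((\sum_(k < 2) prior_shape a D k j) / 2) ((\sum_(k < 2) g k) / 2) A;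
  (* the law of [(L 0 j, L 1 j)] given [sigma2 j], as a disintegration of the
     joint law on rectangles *)
  prior_L : forall (j : 'I_q) (A : set R)
      (B : forall k : 'I_2, set (#|pa (D k) j|.-tuple R)),
    measurable A -> (forall k, measurable (B k)) ->
    P (sigma2 j @^-1` A `&` \bigcap_k (L k j @^-1` B k)) =
    (\int[P]_(w in sigma2 j @^-1` A)
      \prod_(k < 2) mvnormal 0 ((g k)^-1 * sigma2 j w)%:M (B k))%E
}.

End prior.

Section posterior_parameters.
Context (R : realType) (q n : nat) (e : rel 'I_q) (X : 'M[R]_(n, q)) (g : R).
Variable j : 'I_q.

Definition Tbar : 'M[R]_#|pa e j| :=
  g%:M + (pa_cols e X j)^T *m pa_cols e X j.

Definition Lhat : 'cV[R]_#|pa e j| :=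
  invmx Tbar *m ((pa_cols e X j)^T *m col j X).

Definition post_rate : R :=
  g + ((col j X)^T *m col j X) 0 0 - (Lhat^T *m Tbar *m Lhat) 0 0.

End posterior_parameters.

(* Main.v *)
Require Import Defs.
From HB Require Import structures.
From mathcomp Require Import all_boot all_order all_algebra.
From mathcomp Require Import all_classical all_reals all_analysis.
From mathcomp Require Import measurable_realfun.
From mathcomp Require Import ring.

(* By independence of the node blocks, the integral of the likelihood over
   sigma_j^2 in A factors into the contribution of node j times those of the
   other nodes; the latter lie in (0, +oo) and cancel in Bayes' formula.  The
   law of (sigma_j^2, L_j^1, L_j^2) has a density with respect to the product of
   Lebesgue measures, so the contribution of node j is an iterated integral.
   Completing the square in L_j^k and substituting L_j^k = sigma_j u - Lhat_j^k
   turns the inner integrals into a constant times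
   x^(-n_k/2) exp(- (beta^k - g_k) / (2 x)), and multiplying by the prior
   density gives the kernel of the announced inverse gamma distribution. *)

Import Order.TTheory GRing.Theory Num.Theory.
Import numFieldNormedType.Exports.

Local Open Scope classical_set_scope.
Local Open Scope ring_scope.

Set Implicit Arguments.
Unset Strict Implicit.
Unset Printing Implicit Defensive.

(** * Densities, joint laws and independence *)

(** Cancelling a factor in Bayes' formula requires it to be positive and finite, and these two
    properties shape the proof. Finiteness does not come from a bound: the likelihood of a node may
    blow up as its variance tends to 0. It comes from the prior, whose kernel is integrable because
    the prior is a probability; the posterior kernel has a larger shape and a larger rate, and is
    compared with it. Hence the Gamma function is never evaluated: all normalizing constants stay
    abstract and disappear in the quotient. Node 1 needs a separate argument: its variance is the
    constant 1, so the law of its block has no density in the variance variable, but its likelihood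
    is bounded by the Gaussian peaks. The prior prescribes the laws of the coefficients on
    rectangles only, and independence is stated for sets. Passing to integrals of functions takes a
    uniqueness theorem for measures that agree on boxes, and an induction that turns indicators into
    functions. *)

Section weighted_measure.
Local Open Scope ereal_scope.
Context (d : measure_display) (T : measurableType d) (R : realType).
Variable mu : {measure set T -> \bar R}.
Variable w : T -> R.

(* The two proofs are arguments so that the measure structure declared below
   can be inferred from the term itself. *)
Definition weighted of measurable_fun setT w & (forall x, (0 <= w x)%R) :=
  fun A : set T => \int[mu]_(x in A) (w x)%:E.

Hypotheses (mw : measurable_fun setT w) (w0 : forall x, (0 <= w x)%R).
Local Notation wmu := (weighted mw w0).

Let weighted0 : wmu set0 = 0.
Proof. by rewrite /weighted integral_set0. Qed.

Let weighted_ge0 A : 0 <= wmu A.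
Proof. by apply: integral_ge0 => x _; rewrite lee_fin. Qed.

Let weighted_sigma_additive : semi_sigma_additive wmu.
Proof.
move=> F mF tF mUF; rewrite /weighted ge0_integral_bigcup//.
- apply: is_cvg_ereal_nneg_natsum_cond => n _ _.
  by apply: integral_ge0 => x _; rewrite lee_fin.
- by apply: measurable_funTS; exact/measurable_EFinP.
- by move=> x _; rewrite lee_fin.
Qed.

HB.instance Definition _ := isMeasure.Build _ _ _ wmu
  weighted0 weighted_ge0 weighted_sigma_additive.

Import HBNNSimple.

(** Both sides pass to the limit along an increasing sequence of simple functions, so linearity
    reduces the claim to indicators, where it is the definition of [weighted]. The measure [mu] is
    arbitrary, not only sigma-finite. *)
Lemma ge0_integral_weighted (f : T -> \bar R) :
  measurable_fun setT f -> (forall x, 0 <= f x) ->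
  \int[wmu]_x f x = \int[mu]_x (f x * (w x)%:E).
Proof.
move=> mf f0; have mE := @measurableT _ T.
pose h := nnsfun_approx mE mf.
have mwE : measurable_fun setT (EFin \o w) by exact/measurable_EFinP.
have -> : \int[wmu]_x f x = lim (\int[wmu]_x (EFin \o h n) x @[n --> \oo]).
  have fE x : f x = lim ((EFin \o h n) x @[n --> \oo]).
    by apply/esym/cvg_lim => //; exact: cvg_nnsfun_approx.
  under eq_integral => x _ do rewrite fE.
  apply: monotone_convergence => //.
  - by move=> n; exact/measurable_EFinP.
  - by move=> n x Ex //=; rewrite lee_fin.
  - by move=> x Ex a b ab; rewrite lee_fin; exact/lefP/nd_nnsfun_approx.
have -> : \int[mu]_x (f x * (w x)%:E) =
    lim (\int[mu]_x ((EFin \o h n) x * (w x)%:E) @[n --> \oo]).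
  have fg x : f x * (w x)%:E = lim ((EFin \o h n) x * (w x)%:E @[n --> \oo]).
    by apply/esym/cvg_lim => //; apply: cvgeZr => //; exact: cvg_nnsfun_approx.
  under eq_integral => x _ do rewrite fg.
  apply: monotone_convergence => [//| | |].
  - by move=> n; apply/emeasurable_funM => //; exact/measurable_EFinP.
  - by move=> n x Ex /=; rewrite mule_ge0 ?lee_fin.
  - move=> x Ex a b ab/=; rewrite lee_wpmul2r ?lee_fin//.
    exact/lefP/nd_nnsfun_approx.
apply: congr_lim; apply/funext => n /=.
transitivity (\int[wmu]_x
   (\sum_(y \in range (h n)) (y * \1_(h n @^-1` [set y]) x)%:E)).
  by apply: eq_integral => t tE; rewrite /= fimfunE -fsumEFin.
rewrite ge0_integral_fsum//; last 2 first.
  - by move=> r; exact/measurable_EFinP/measurable_funM.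
  - by move=> m y Ey; exact: nnfun_muleindic_ge0.
transitivity (\int[mu]_x (\sum_(y \in range (h n))
    (y * \1_(h n @^-1` [set y]) x)%:E * (w x)%:E)); last first.
  apply: eq_integral => x _; rewrite (fimfunE (h n) x) -fsumEFin//.
  by rewrite ge0_mule_fsuml// => y; exact: nnfun_muleindic_ge0.
rewrite ge0_integral_fsum//; last 2 first.
  - move=> y; apply: emeasurable_funM => //.
    exact/measurable_EFinP/measurable_funM.
  - by move=> m y Ey; rewrite mule_ge0 ?lee_fin// -lee_fin nnfun_muleindic_ge0.
apply: eq_fsbigr => r rhn.
under [LHS]eq_integral do rewrite EFinM.
rewrite integralZl_indic_nnsfun//.
under [RHS]eq_integral do rewrite EFinM -muleA.
rewrite ge0_integralZl//.
- congr (_ * _); rewrite integral_indic// setIT.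
  rewrite [RHS](eq_integral ((EFin \o w) \_ (h n @^-1` [set r]))).
    by rewrite -integral_mkcond.
  by move=> x _; rewrite epatch_indic /= muleC.
- by apply: emeasurable_funM => //; exact/measurable_EFinP.
- by move=> t Et; rewrite mule_ge0 ?lee_fin.
- by move: rhn; rewrite inE => -[t _ <-]; rewrite lee_fin.
Qed.

End weighted_measure.

(** The hypothesis on sets says that [nu] is the image under [Y] of the measure with density [w]. It
    serves with [Y := id] to replace a law by its density, and with [w] a product of other factors
    to isolate one variable in the independence argument. *)
Lemma ge0_integral_transfer (d d' : measure_display) (T : measurableType d)
    (S : measurableType d') (R : realType) (mu : {measure set T -> \bar R})
    (nu : {measure set S -> \bar R}) (w : T -> R) (Y : T -> S)
    (f : S -> \bar R) :
  measurable_fun setT w -> (forall x, 0 <= w x) -> measurable_fun setT Y ->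
  (forall B, measurable B -> \int[mu]_(x in Y @^-1` B) (w x)%:E = nu B)%E ->
  measurable_fun setT f -> (forall y, 0 <= f y)%E ->
  (\int[mu]_x (f (Y x) * (w x)%:E) = \int[nu]_y f y)%E.
Proof.
move=> mw w0 mY wY mf f0.
rewrite -(@ge0_integral_weighted _ _ _ mu w mw w0 (f \o Y)).
- transitivity (\int[pushforward (weighted mu mw w0) Y]_y f y)%E.
    by rewrite ge0_integral_pushforward.
  pose mfY := mfun_Sub (mem_set mY) : {mfun T >-> S}.
  rewrite -[Y]/(mfY : T -> S).
  by apply: eq_measure_integral => A mA _; exact: wY.
- exact: measurableT_comp.
- by move=> x; exact: f0.
Qed.

Section boxes.
Local Open Scope ereal_scope.
Context (d1 d2 d3 : measure_display) (T1 : measurableType d1).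
Context (T2 : measurableType d2) (T3 : measurableType d3) (R : realType).

Lemma measure_unique_boxes
    (m1 m2 : {measure set (T1 * T2 * T3) -> \bar R}) :
  m1 setT < +oo ->
  (forall A B C, measurable A -> measurable B -> measurable C ->
    m1 (A `*` B `*` C) = m2 (A `*` B `*` C)) ->
  forall X, measurable X -> m1 X = m2 X.
Proof.
move=> m1oo m12 X mX.
pose G : set (set (T1 * T2 * T3)) := [set X | exists A B C,
  [/\ measurable A, measurable B, measurable C & X = A `*` B `*` C]].
have GT : G setT by exists setT, setT, setT; split => //; rewrite !setXTT.
apply: (measure_unique G (fun=> setT)) => //.
- apply/seteqP; split; last first.
    apply: smallest_sub; first exact: sigma_algebra_measurable.
    by move=> _ [A [B [C [mA mB mC ->]]]]; do 2?apply: measurableX.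
  move=> Y mY.
  (* A preimage under one coordinate is a box with two full sides, so the identity is measurable
     from the generated sigma-algebra to the product one; hence boxes generate the latter. *)
  suff mid : measurable_fun setT (id : g_sigma_algebraType G -> T1 * T2 * T3).
    by rewrite -[Y]setTI -[Y]preimage_id; exact: mid.
  apply/measurable_fun_pairP; split; first apply/measurable_fun_pairP.
    split.
  + move=> _ A mA; rewrite setTI; apply: sub_sigma_algebra.
    exists A, setT, setT; split => //.
    by apply/seteqP; split => // -[[]] //= ? ? ? [[]].
  + move=> _ A mA; rewrite setTI; apply: sub_sigma_algebra.
    exists setT, A, setT; split => //.
    by apply/seteqP; split => // -[[]] //= ? ? ? [[]].
  + move=> _ A mA; rewrite setTI; apply: sub_sigma_algebra.
    exists setT, setT, A; split => //.
    by apply/seteqP; split => // -[[]] //= ? ? ? [[]].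
- move=> _ _ [A [B [C [mA mB mC ->]]]] [A' [B' [C' [mA' mB' mC' ->]]]].
  exists (A `&` A'), (B `&` B'), (C `&` C'); split => //; try exact: measurableI.
  by rewrite -!setXI.
- by rewrite bigcup_const.
- by move=> _ [A [B [C [mA mB mC ->]]]]; exact: m12.
Qed.

End boxes.

Section independence.
Context (d : measure_display) (T : measurableType d) (R : realType).
Variables (P : probability T R) (I : finType) (dS : I -> measure_display).
Variables (S : forall i, measurableType (dS i)) (Y : forall i, {RV P >-> S i}).
Hypothesis indep : mutually_independent Y.

Let expect (i : I) (f : S i -> R) := (\int[P]_t (f (Y i t))%:E)%E.

Let expect_indic i (B : set (S i)) : measurable B ->
  expect (\1_B : S i -> R) = P (Y i @^-1` B).
Proof.
move=> mB; rewrite /expect -(setIT (Y i @^-1` B)) -integral_indic//.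
by rewrite -[X in measurable X]setTI; exact: measurable_funP.
Qed.

Let measurable_fun_RV i (f : S i -> R) : measurable_fun setT f ->
  measurable_fun setT (fun t => f (Y i t)).
Proof. by move=> mf; exact: measurableT_comp. Qed.

(* Indicators are replaced by arbitrary functions one index at a time. *)
Let integral_prod_partial (r : seq I) (F : forall i, S i -> R) :
  (forall i, measurable_fun setT (F i)) -> (forall i x, 0 <= F i x) ->
  (forall i, expect (F i) < +oo)%E ->
  (forall i, i \notin r -> exists B, measurable B /\ F i = \1_B) ->
  (\int[P]_t (\prod_(i : I) F i (Y i t))%:E = \prod_(i : I) expect (F i))%E.
Proof.
elim: r F => [|i0 r IH] F mF F0 Foo FB.
  have {}FB i : {B | measurable B /\ F i = \1_B}.
    by apply: cid; exact: FB.
  pose B i := projT1 (FB i).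
  have mB i : measurable (B i) by have [] := projT2 (FB i).
  have FE i : F i = \1_(B i) by have [] := projT2 (FB i).
  under [RHS]eq_bigr do rewrite FE expect_indic//.
  rewrite -indep//.
  rewrite -(setIT (\bigcap_i _)) -integral_indic//; last first.
    apply: fin_bigcap_measurable => [|i _]; first exact: finite_finset.
    by rewrite -[X in measurable X]setTI; exact: measurable_funP.
  apply: eq_integral => t _; congr (_%:E).
  rewrite indicE; case: (boolP (t \in _)) => [/set_mem tB|/negP tB].
    rewrite big1// => i _; rewrite FE indicE mem_set//.
    exact: tB.
  have [i Bi] : exists i, ~ B i (Y i t).
    by apply/existsNP => tB'; apply: tB; apply/mem_set => i _; exact: tB'.
  by rewrite (bigD1 i)//= FE indicE memNset// mul0r.
(* The other factors are treated as a density [W] on the sample space. The finiteness hypothesis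
   makes their expected product a real number [c], which can scale a measure. *)
pose W t := \prod_(i | i != i0) F i (Y i t).
pose c := \prod_(i | i != i0) fine (expect (F i)).
have efin i : expect (F i) \is a fin_num.
  by rewrite ge0_fin_numE//; apply: integral_ge0 => t _; rewrite lee_fin.
have c0 : 0 <= c.
  apply: prodr_ge0 => i _; rewrite fine_ge0// integral_ge0// => t _.
  by rewrite lee_fin.
have cE : (\prod_(i | i != i0) expect (F i) = c%:E)%E.
  by rewrite -prodEFin; apply: eq_bigr => i _; rewrite fineK.
have mW : measurable_fun setT W.
  rewrite /W; under eq_fun do rewrite -big_filter.
  by apply: measurable_prod => i _; exact: measurable_fun_RV.
have W0 t : 0 <= W t by exact: prodr_ge0.
(* The induction hypothesis, with [F i0] replaced by the indicator of [B], says that weighting by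
   [W] turns the law of [Y i0] into [c] times itself. Then [F i0] can be integrated against it. *)
have key (B : set (S i0)) : measurable B ->
    (\int[P]_(t in Y i0 @^-1` B) (W t)%:E =
      mscale (NngNum c0) (distribution P (Y i0)) B)%E.
  move=> mB; pose G := dfwith F i0 (\1_B : S i0 -> R).
  have Gi0 : G i0 = \1_B by rewrite /G dfwithin.
  have Gi i : i != i0 -> G i = F i by move=> ii0; rewrite /G dfwithout// eq_sym.
  have IHG : (\int[P]_t (\prod_i G i (Y i t))%:E = \prod_i expect (G i))%E.
    apply: IH => [i|i x|i|i ir].
    - by have [->|/Gi->//] := eqVneq i i0; rewrite Gi0.
    - by case: (eqVneq i i0) x => [->|/Gi->//] x; rewrite Gi0.
    - have [->|/Gi->//] := eqVneq i i0; rewrite Gi0 expect_indic//.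
      rewrite (le_lt_trans (probability_le1 P _)) ?ltry//.
      by rewrite -[X in measurable X]setTI; exact: measurable_funP.
    - have [->|ii0] := eqVneq i i0; first by exists B.
      by rewrite Gi//; apply: FB; rewrite inE negb_or ii0.
  have -> : mscale (NngNum c0) (distribution P (Y i0)) B =
      (\prod_i expect (G i))%E.
    rewrite (bigD1 i0)//= Gi0 expect_indic// muleC.
    by rewrite (eq_bigr (fun i => expect (F i))) ?cE// => i /Gi ->.
  rewrite -IHG [LHS]integral_mkcond; apply: eq_integral => t _.
  rewrite patchE [in RHS](bigD1 i0)//= Gi0 indicE.
  rewrite -[_ \in _ @^-1` _]/(Y i0 t \in B); case: ifP => _; last by rewrite mul0r.
  by rewrite mul1r; congr (_%:E); apply: eq_bigr => i /Gi ->.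
have mE : measurable_fun setT (EFin \o F i0) by exact/measurable_EFinP.
have := @ge0_integral_transfer _ _ _ _ _ P
  (mscale (NngNum c0) (distribution P (Y i0))) W (Y i0) (EFin \o F i0) mW W0
  (measurable_funP (Y i0)) key mE (fun y => F0 i0 y).
rewrite ge0_integral_mscale//; last by move=> x _; rewrite lee_fin.
rewrite ge0_integral_distribution//=; last by move=> y; rewrite lee_fin.
move=> H.
rewrite [RHS](bigD1 i0)//= cE muleC -[X in (_ * X)%E]/(expect (F i0)) -H.
by apply: eq_integral => t _; rewrite (bigD1 i0)//= EFinM.
Qed.

Lemma independent_integral_prod (h : forall i, S i -> R) :
  (forall i, measurable_fun setT (h i)) -> (forall i x, 0 <= h i x) ->
  (forall i, \int[P]_t (h i (Y i t))%:E < +oo)%E ->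
  (\int[P]_t (\prod_(i : I) h i (Y i t))%:E =
   \prod_(i : I) \int[P]_t (h i (Y i t))%:E)%E.
Proof.
move=> mh h0 hoo; apply: (@integral_prod_partial (enum I)) => // i.
by rewrite mem_enum.
Qed.

End independence.

Lemma integral_patch_indic (d : measure_display) (T : measurableType d)
    (R : realType) (mu : {measure set T -> \bar R}) (A : set T) (f : T -> R) :
  (\int[mu]_(x in A) (f x)%:E = \int[mu]_x (f x * \1_A x)%:E)%E.
Proof.
rewrite [LHS]integral_mkcond; apply: eq_integral => x _.
by rewrite patchE indicE; case: ifP => _; rewrite ?mulr1 ?mulr0.
Qed.

Lemma ge0_integral_prod_pair (d1 d2 : measure_display) (T1 : measurableType d1)
    (T2 : measurableType d2) (R : realType) (m1 : {measure set T1 -> \bar R})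
    (m2 : {measure set T2 -> \bar R}) (f1 : T1 -> R) (f2 : T2 -> R) :
  measurable_fun setT f1 -> measurable_fun setT f2 ->
  (forall x, 0 <= f1 x) -> (forall x, 0 <= f2 x) ->
  (\int[m1]_x \int[m2]_y (f1 x * f2 y)%:E =
   \int[m1]_x (f1 x)%:E * \int[m2]_y (f2 y)%:E)%E.
Proof.
move=> mf1 mf2 f10 f20.
rewrite -ge0_integralZr//; first last.
- by apply: integral_ge0 => x _; rewrite lee_fin.
- by move=> x _; rewrite lee_fin.
- exact/measurable_EFinP.
apply: eq_integral => x _; under eq_integral do rewrite EFinM.
rewrite ge0_integralZl// ?lee_fin//; first exact/measurable_EFinP.
by move=> y _; rewrite lee_fin.
Qed.

Lemma sigma_finite_product (d1 d2 : measure_display) (T1 : measurableType d1)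
    (T2 : measurableType d2) (R : realType)
    (m1 : {sigma_finite_measure set T1 -> \bar R})
    (m2 : {sigma_finite_measure set T2 -> \bar R}) :
  sigma_finite setT (m1 \x m2)%E.
Proof.
have /sigma_finiteP[F [FT ndF Foo]] := sigma_finiteT m1.
have /sigma_finiteP[G [GT ndG Goo]] := sigma_finiteT m2.
exists (fun i => F i `*` G i) => [|i]; last first.
  have [[mF Fioo] [mG Gioo]] := (Foo i, Goo i); split; first exact: measurableX.
  by rewrite product_measure1E// lte_mul_pinfty// ge0_fin_numE.
apply/seteqP; split => // -[x y] _.
have [i _ Fi] : (\bigcup_i F i) x by rewrite -FT.
have [j _ Gj] : (\bigcup_i G i) y by rewrite -GT.
exists (maxn i j) => //; split => /=.
- by move: Fi; exact/subsetPset/ndF/leq_maxl.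
- by move: Gj; exact/subsetPset/ndG/leq_maxr.
Qed.

Section joint_law.
Context (dT dS d0 d1 : measure_display) (T : measurableType dT).
Context (S : measurableType dS) (S0 : measurableType d0).
Context (S1 : measurableType d1) (R : realType) (P : probability T R).
Variables (s : {RV P >-> S}) (Y0 : {RV P >-> S0}) (Y1 : {RV P >-> S1}).
Variables (mu : {sigma_finite_measure set S -> \bar R}).
Variables (m0 : {sigma_finite_measure set S0 -> \bar R}).
Variables (m1 : {sigma_finite_measure set S1 -> \bar R}).
Variables (w : S -> R) (f0 : S * S0 -> R) (f1 : S * S1 -> R).
Hypotheses (mw : measurable_fun setT w) (mf0 : measurable_fun setT f0).
Hypothesis (mf1 : measurable_fun setT f1).
Hypotheses (w_ge0 : forall x, 0 <= w x) (f0_ge0 : forall z, 0 <= f0 z).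
Hypothesis (f1_ge0 : forall z, 0 <= f1 z).
Hypothesis law_s : forall A, measurable A ->
  (P (s @^-1` A) = \int[mu]_(x in A) (w x)%:E)%E.
Hypothesis law_Y : forall A B0 B1, measurable A -> measurable B0 ->
  measurable B1 ->
  (P (s @^-1` A `&` (Y0 @^-1` B0 `&` Y1 @^-1` B1)) =
   \int[P]_(t in s @^-1` A)
     (\int[m0]_(y in B0) (f0 (s t, y))%:E * \int[m1]_(y in B1) (f1 (s t, y))%:E))%E.

Let dens (z : S * S0 * S1) := w z.1.1 * (f0 z.1 * f1 (z.1.1, z.2)).

Let mfst11 : measurable_fun setT (fun z : S * S0 * S1 => z.1.1).
Proof. exact: (measurableT_comp measurable_fst measurable_fst). Qed.

Let mdens : measurable_fun setT dens.
Proof.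
apply: measurable_funM; first exact: measurableT_comp.
apply: measurable_funM; first exact: measurableT_comp.
by apply: measurableT_comp => //; exact: measurable_fun_pair.
Qed.

Let dens_ge0 z : 0 <= dens z.
Proof. by rewrite !mulr_ge0. Qed.

(* The library's sigma-finite instance on products is shadowed by the one for
   subprobabilities, hence the explicit packing. *)
Let mu0 : {sigma_finite_measure set (S * S0)%type -> \bar R} :=
  HB.pack (mu \x m0)%E
    (Measure_isSigmaFinite.Build _ _ _ (mu \x m0)%E (sigma_finite_product mu m0)).

Let tonelli3 (f : S * S0 * S1 -> R) : measurable_fun setT f ->
  (forall z, 0 <= f z) ->
  (\int[mu0 \x m1]_z (f z)%:E =
   \int[mu]_x \int[m0]_y0 \int[m1]_y1 (f (x, y0, y1))%:E)%E.
Proof.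
move=> mf f_ge0.
have mfE : measurable_fun setT (EFin \o f) by exact/measurable_EFinP.
have fE0 z : (0 <= (EFin \o f) z)%E by rewrite lee_fin.
apply: (eq_trans (@fubini_tonelli1 _ _ _ _ R mu0 m1 _ mfE fE0)).
apply: (@fubini_tonelli1 _ _ _ _ R mu m0 (fubini_F m1 (EFin \o f))).
- exact: measurable_fun_fubini_tonelli_F.
- by move=> z; apply: integral_ge0 => y _; rewrite lee_fin.
Qed.

Let joint t := (s t, Y0 t, Y1 t).

Let mjoint : measurable_fun setT joint.
Proof. by do 2?apply: measurable_fun_pair. Qed.

Let law_box A B0 B1 : measurable A -> measurable B0 -> measurable B1 ->
  (\int[mu0 \x m1]_(z in A `*` B0 `*` B1) (dens z)%:E =
   P (joint @^-1` (A `*` B0 `*` B1)))%E.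
Proof.
move=> mA mB0 mB1.
have -> : joint @^-1` (A `*` B0 `*` B1) =
    s @^-1` A `&` (Y0 @^-1` B0 `&` Y1 @^-1` B1).
  by apply/seteqP; split => t /= [] // => [[]|? []].
rewrite law_Y//.
pose g0 (z : S * S0) := f0 z * \1_B0 z.2.
pose g1 (z : S * S1) := f1 z * \1_B1 z.2.
have mg0 : measurable_fun setT g0.
  by apply: measurable_funM => //; apply: measurableT_comp.
have mg1 : measurable_fun setT g1.
  by apply: measurable_funM => //; apply: measurableT_comp.
have g0_ge0 z : 0 <= g0 z by rewrite mulr_ge0.
have g1_ge0 z : 0 <= g1 z by rewrite mulr_ge0.
pose I0 := fubini_F m0 (EFin \o g0); pose I1 := fubini_F m1 (EFin \o g1).
have mI0 : measurable_fun setT I0.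
  apply: measurable_fun_fubini_tonelli_F => [|z]; last by rewrite lee_fin.
  exact/measurable_EFinP.
have mI1 : measurable_fun setT I1.
  apply: measurable_fun_fubini_tonelli_F => [|z]; last by rewrite lee_fin.
  exact/measurable_EFinP.
have I0_ge0 x : (0 <= I0 x)%E by apply: integral_ge0 => y _; rewrite lee_fin.
have I1_ge0 x : (0 <= I1 x)%E by apply: integral_ge0 => y _; rewrite lee_fin.
have mIA : measurable_fun setT (fun x => (\1_A x)%:E * (I0 x * I1 x))%E.
  by apply: emeasurable_funM; [exact/measurable_EFinP|exact: emeasurable_funM].
have IA_ge0 x : (0 <= (\1_A x)%:E * (I0 x * I1 x))%E.
  by rewrite mule_ge0 ?mule_ge0// lee_fin.
(* The conditional probabilities of [B0] and [B1] depend on [t] only through [s t], so the integral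
   over [P] becomes one over the law of [s], and then one over [mu] with density [w]. *)
transitivity (\int[distribution P s]_x ((\1_A x)%:E * (I0 x * I1 x)))%E; last first.
  rewrite ge0_integral_distribution// [RHS]integral_mkcond.
  apply: eq_integral => t _; rewrite patchE /= indicE.
  rewrite -[_ \in s @^-1` _]/(s t \in A); case: ifP => _; last by rewrite mul0e.
  rewrite mul1e; congr (_ * _)%E; apply/esym; rewrite /I0 /I1 /fubini_F /=.
  - exact: integral_patch_indic.
  - exact: integral_patch_indic.
rewrite -(@ge0_integral_transfer _ _ _ _ _ mu (distribution P s) w id
  (fun x => (\1_A x)%:E * (I0 x * I1 x))%E)//; last first.
  by move=> B mB; rewrite preimage_id -law_s.
rewrite integral_patch_indic tonelli3; last 2 first.
- apply: measurable_funM => //; apply: measurable_indic.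
  by do 2?apply: measurableX.
- by move=> z; rewrite mulr_ge0.
apply: eq_integral => x _.
(* The indicator of a box splits into one factor per coordinate, which makes the inner double
   integral a product. *)
transitivity (\int[m0]_y0 \int[m1]_y1
    ((w x * \1_A x * g0 (x, y0)) * g1 (x, y1))%:E)%E.
  apply: eq_integral => y0 _; apply: eq_integral => y1 _; congr (_%:E).
  rewrite /dens /g0 /g1 /= !indicE !in_setX/=.
  by case: (x \in A); case: (y0 \in B0); case: (y1 \in B1);
    rewrite /= ?(mulr1, mulr0, mul0r, mulrA).
rewrite (@ge0_integral_prod_pair _ _ _ _ _ m0 m1
  (fun y0 => w x * \1_A x * g0 (x, y0)) (fun y1 => g1 (x, y1)))//; first last.
- by move=> y0; rewrite !mulr_ge0.
- exact: measurable_fun_pair2.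
- by apply: measurable_funM => //; exact: measurable_fun_pair2.
under eq_integral do rewrite EFinM.
rewrite ge0_integralZl//; first last.
- by rewrite lee_fin mulr_ge0.
- by move=> y _; rewrite lee_fin.
- by apply/measurable_EFinP; exact: measurable_fun_pair2.
by rewrite -[X in (_ * X * _)%E]/(I0 x) -[X in (_ * _ * X)%E]/(I1 x) EFinM
  [RHS]muleC !muleA.
Qed.

(** The joint law and the measure with density [dens] agree on boxes by [law_box]. The joint law is
    finite, so they agree on all measurable sets; Tonelli then gives the iterated integral. *)
Lemma integral_joint_law (f : S * S0 * S1 -> R) : measurable_fun setT f ->
  (forall z, 0 <= f z) ->
  (\int[P]_t (f (s t, Y0 t, Y1 t))%:E =
   \int[mu]_x \int[m0]_y0 \int[m1]_y1
     (f (x, y0, y1) * (w x * (f0 (x, y0) * f1 (x, y1))))%:E)%E.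
Proof.
move=> mf f_ge0.
have mfE : measurable_fun setT (EFin \o f) by exact/measurable_EFinP.
rewrite -(tonelli3 (f := fun z => f z * dens z)); first last.
- by move=> z; rewrite mulr_ge0.
- exact: measurable_funM.
under [RHS]eq_integral do rewrite EFinM.
pose mj := mfun_Sub (mem_set mjoint) : {RV P >-> _}.
have := @ge0_integral_transfer _ _ _ _ _ (mu0 \x m1)%E
  (distribution P mj) dens id (EFin \o f) mdens dens_ge0.
move=> ->//; first by rewrite ge0_integral_distribution// => z; rewrite lee_fin.
- move=> B mB; rewrite preimage_id; apply/esym.
  apply: (@measure_unique_boxes _ _ _ _ _ _ _ (distribution P mj)
    (weighted (mu0 \x m1)%E mdens dens_ge0)) => //.
    by apply: le_lt_trans (ltry 1); exact: probability_le1.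
  by move=> A B0 B1 mA mB0 mB1; exact/esym/law_box.
Qed.

End joint_law.

(** * Lebesgue integration over tuples *)

Section lebesgue_tuple_integral.
Context (R : realType).
Local Notation lambda := (@lebesgue_measure R).

Lemma integral_lebesgue_tuple0 (f : 0.-tuple R -> \bar R) :
  measurable_fun setT f ->
  (\int[lebesgue_tuple R 0]_t f t = f [tuple])%E.
Proof. by move=> mf; rewrite integral_dirac// diracT mul1e. Qed.

Lemma measurable_fun_cons_pair n :
  measurable_fun setT
    (fun z : measurableTypeR R * n.-tuple R =>
      [tuple of z.1 :: z.2] : n.+1.-tuple R).
Proof. by apply: measurable_cons. Qed.

Lemma integral_lebesgue_tupleS n (f : n.+1.-tuple R -> \bar R) :
  measurable_fun setT f -> (forall t, 0 <= f t)%E ->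
  (\int[lebesgue_tuple R n.+1]_t f t =
   \int[lambda]_x \int[lebesgue_tuple R n]_t f [tuple of x :: t])%E.
Proof.
move=> mf f0.
transitivity (\int[lebesgue_measure \x lebesgue_tuple R n]_z
    f [tuple of z.1 :: z.2])%E.
  have := ge0_integral_pushforward (@measurable_fun_cons_pair n)
    (lebesgue_measure \x lebesgue_tuple R n)%E measurableT mf (fun t _ => f0 t).
  by rewrite preimage_setT.
apply: (@fubini_tonelli1 _ _ _ _ R lebesgue_measure (lebesgue_tuple R n)
  (fun z => f [tuple of z.1 :: z.2])) => //.
exact: (measurableT_comp mf (@measurable_fun_cons_pair n)).
Qed.

(** The image of Lebesgue measure under the affine map, multiplied by [c], gives half-open intervals
    their length, and this characterizes Lebesgue measure. *)
Lemma lebesgue_measure_affine (c a : R) (c0 : 0 < c) (A : set R) :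
  measurable A ->
  lambda A = (c%:E * lambda ((fun x => c * x + a)%R @^-1` A))%E.
Proof.
move=> mA.
pose phi (x : measurableTypeR R) : measurableTypeR R := c * x + a.
have mphi : measurable_fun setT phi.
  by apply: measurable_funD => //; exact: measurable_funM.
have cge0 := ltW c0.
apply: (@lebesgue_measure_unique R
  (mscale (NngNum cge0) (pushforward lebesgue_measure phi))) => // _ [[p q]] _ <-.
rewrite -[RHS]/(c%:E * lebesgue_measure (phi @^-1` `]p, q]%classic))%E.
have -> : phi @^-1` `]p, q] = `](p - a) / c, (q - a) / c]%classic.
  apply/seteqP; split => x /=; rewrite !in_itv/= ltr_pdivrMr// ler_pdivlMr//;
    by rewrite ltrBlDr lerBrDr [x * c]mulrC.
rewrite !lebesgue_measure_itv/= !lte_fin ltr_pM2r ?invr_gt0// ltrD2r.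
case: ifP => _; last by rewrite mule0.
by rewrite -EFinD -EFinM; congr (_%:E); field; rewrite gt_eqF.
Qed.

Lemma integral_affine (c a : R) (f : R -> \bar R) : 0 < c ->
  measurable_fun setT f -> (forall x, 0 <= f x)%E ->
  (\int[lambda]_x f x = c%:E * \int[lambda]_x f (c * x + a)%R)%E.
Proof.
move=> c0 mf f0.
pose phi (x : measurableTypeR R) : measurableTypeR R := c * x + a.
have mphi : measurable_fun setT phi.
  by apply: measurable_funD => //; exact: measurable_funM.
have cge0 := ltW c0.
pose push : {measure set (measurableTypeR R) -> \bar R} :=
  pushforward lebesgue_measure phi.
transitivity (\int[mscale (NngNum cge0) (push mphi)]_x f x)%E.
  apply: eq_measure_integral => A mA _.
  exact: lebesgue_measure_affine.
rewrite ge0_integral_mscale//; congr (_ * _)%E.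
exact: (ge0_integral_pushforward mphi).
Qed.

Definition affine_tuple n (c : R) (a t : n.-tuple R) : n.-tuple R :=
  [tuple c * tnth t i + tnth a i | i < n].

Lemma measurable_affine_tuple n (c : R) (a : n.-tuple R) :
  measurable_fun setT (affine_tuple c a).
Proof.
apply/measurable_fun_tnthP => i.
rewrite (_ : _ \o _ = fun t => c * tnth t i + tnth a i); last first.
  by apply/funext => t /=; rewrite tnth_mktuple.
apply: measurable_funD => //; apply: measurable_funM => //.
exact: measurable_tnth.
Qed.

Lemma affine_tuple_cons n (c x : R) (a : n.+1.-tuple R) (t : n.-tuple R) :
  affine_tuple c a [tuple of x :: t] =
  [tuple of (c * x + thead a) :: affine_tuple c [tuple of behead a] t].
Proof.
apply: eq_from_tnth => i; rewrite tnth_mktuple.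
have [->|[k ->]] : i = ord0 \/ exists k, i = lift ord0 k.
  by case: (unliftP ord0 i) => [k ->|->]; [right; exists k|left].
  by rewrite !tnth0.
by rewrite !tnthS tnth_mktuple tnth_behead -[inord _](_ : lift ord0 k = _)//;
  apply/val_inj; rewrite /= inordK// ltnS.
Qed.

(** All coordinates are dilated by the same factor, so peeling them off one at a time with Tonelli
    suffices: each contributes one [c] to the Jacobian. *)
Lemma integral_affine_tuple n (c : R) (a : n.-tuple R) (f : n.-tuple R -> \bar R) :
  0 < c -> measurable_fun setT f -> (forall x, 0 <= f x)%E ->
  (\int[lebesgue_tuple R n]_t f t =
   (c ^+ n)%:E * \int[lebesgue_tuple R n]_t f (affine_tuple c a t))%E.
Proof.
move=> c0; elim: n a f => [|n IH] a f mf f0.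
  rewrite !integral_lebesgue_tuple0//; last first.
    exact: measurableT_comp (measurable_affine_tuple _ _).
  by rewrite expr0 mul1e [affine_tuple _ _ _]tuple0.
rewrite !integral_lebesgue_tupleS//; last first.
  exact: measurableT_comp (measurable_affine_tuple _ _).
pose b : n.-tuple R := [tuple of behead a].
pose G x := (\int[lebesgue_tuple R n]_t f [tuple of x :: affine_tuple c b t])%E.
have mfx x : measurable_fun setT (fun t : n.-tuple R => f [tuple of x :: t]).
  by apply: measurableT_comp => //; apply: measurable_cons.
have G0 x : (0 <= G x)%E by exact: integral_ge0.
have mG : measurable_fun setT G.
  apply: (measurable_fun_fubini_tonelli_F
    (fun z : R * n.-tuple R => f [tuple of z.1 :: affine_tuple c b z.2])) => //.
  apply: measurableT_comp => //; apply: measurable_cons => //.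
  exact: measurableT_comp (measurable_affine_tuple _ _) _.
transitivity (\int[lambda]_x ((c ^+ n)%:E * G x))%E.
  by apply: eq_integral => x _; rewrite (IH b).
have mG' : @measurable_fun _ _ (measurableTypeR R) _ setT G := mG.
rewrite (ge0_integralZl _ measurableT mG' (fun x _ => G0 x)); last first.
  by rewrite lee_fin exprn_ge0// ltW.
rewrite (integral_affine (thead a) c0 mG G0) muleA -EFinM -exprSr.
congr (_ * _)%E; apply: eq_integral => x _; rewrite /G; apply: eq_integral => t _.
by rewrite affine_tuple_cons.
Qed.

Lemma integral_lebesgue_tuple_prod n (f : R -> R) :
  measurable_fun setT f -> (forall x, 0 <= f x) ->
  (\int[lebesgue_tuple R n]_t (\prod_(i < n) f (tnth t i))%:E =
   \prod_(i < n) \int[lambda]_x (f x)%:E)%E.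
Proof.
move=> mf f0; have mprod m : measurable_fun setT
    (fun t : m.-tuple R => \prod_(i < m) f (tnth t i)).
  apply: measurable_prod => i _; apply: measurableT_comp => //.
  exact: measurable_tnth.
elim: n => [|n IH].
  rewrite integral_lebesgue_tuple0; last by apply/measurable_EFinP; exact: mprod.
  by rewrite !big_ord0.
rewrite integral_lebesgue_tupleS//; first last.
- by move=> t; rewrite lee_fin prodr_ge0.
- by apply/measurable_EFinP; exact: mprod.
have prod_ge0 (t : n.-tuple R) : 0 <= \prod_(i < n) f (tnth t i).
  by rewrite prodr_ge0.
rewrite big_ord_recl -IH.
apply: (eq_trans _ (@ge0_integral_prod_pair _ _ (measurableTypeR R) _ _
  lebesgue_measure (lebesgue_tuple R n) f _ mf (mprod n) f0 prod_ge0)).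
apply: eq_integral => x _; apply: eq_integral => t _; congr (_%:E).
rewrite big_ord_recl tnth0; congr (_ * _).
by apply: eq_bigr => i _; rewrite tnthS.
Qed.

(** The product formula for the constant function 1 reduces this to the line, which contains the
    unit interval. *)
Lemma lebesgue_tuple_setT_gt0 n : (0 < lebesgue_tuple R n setT)%E.
Proof.
have -> : lebesgue_tuple R n setT = (\prod_(i < n) \int[lambda]_x 1%:E)%E.
  rewrite -(@integral_lebesgue_tuple_prod n (cst 1))//.
  rewrite -[LHS]mul1e -integral_cst//.
  by apply: eq_integral => t _; rewrite big1.
apply: (big_ind (fun x => 0 < x)%E) => [||i _].
- by rewrite lte_fin.
- by move=> x y; exact: mule_gt0.
- rewrite integral_cst// mul1e.
  have : (lambda `[0%R, 1%R]%classic <= lambda setT)%E.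
    by apply: le_measure; rewrite ?inE.
  apply: lt_le_trans; rewrite lebesgue_measure_itv/= lte_fin ltr01.
  by rewrite oppr0 adde0 lte_fin.
Qed.

End lebesgue_tuple_integral.

(** * Gaussian integrals *)

(** If the integral were 0, [f] would vanish outside a null set, and that null set would contain
    every point where [f] is positive. *)
Lemma integral_gt0 (d : measure_display) (T : measurableType d) (R : realType)
    (mu : {measure set T -> \bar R}) (f : T -> \bar R) :
  measurable_fun setT f -> (forall x, 0 <= f x)%E ->
  (0 < mu [set x | 0 < f x])%E -> (0 < \int[mu]_x f x)%E.
Proof.
move=> mf f0 mu0; rewrite lt0e integral_ge0// andbT; apply/eqP => intf0.
have : (\int[mu]_x `|f x| = 0)%E.
  by rewrite -intf0; apply: eq_integral => x _; rewrite gee0_abs.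
move/(ae_eq_integral_abs mu measurableT mf)=> [N [mN N0 fN]].
have sN : [set x | 0 < f x]%E `<=` N.
  by move=> x /= fx; apply: fN => /= /(_ I) fx0; move: fx; rewrite fx0 ltxx.
have : (mu [set x | 0 < f x] <= mu N)%E.
  apply: le_measure; rewrite ?inE// -[X in measurable X]setTI.
  exact: emeasurable_fun_o_infty.
by rewrite N0 leNgt mu0.
Qed.

Section gaussian.
Context (R : realType).

Definition sqnorm n (u : 'cV[R]_n) : R := (u^T *m u) 0 0.

Lemma sqnormE n (u : 'cV[R]_n) : sqnorm u = \sum_i u i 0 ^+ 2.
Proof. by rewrite /sqnorm mxE; apply: eq_bigr => i _; rewrite !mxE expr2. Qed.

Lemma sqnorm_ge0 n (u : 'cV[R]_n) : 0 <= sqnorm u.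
Proof. by rewrite sqnormE; apply: sumr_ge0 => i _; exact: sqr_ge0. Qed.

Lemma sqnorm_eq0 n (u : 'cV[R]_n) : sqnorm u = 0 -> u = 0.
Proof.
move=> /eqP; rewrite sqnormE psumr_eq0; last by move=> i _; exact: sqr_ge0.
move=> /allP u0; apply/matrixP => i j; rewrite (ord1 j) mxE.
by have := u0 i (mem_index_enum i); rewrite implyTb sqrf_eq0 => /eqP.
Qed.

Lemma sqnormZ n a (u : 'cV[R]_n) : sqnorm (a *: u) = a ^+ 2 * sqnorm u.
Proof.
by rewrite !sqnormE mulr_sumr; apply: eq_bigr => i _; rewrite mxE exprMn.
Qed.

Lemma measurable_sqnorm (d : measure_display) (S : measurableType d) n
    (u : S -> 'cV[R]_n) :
  (forall i, measurable_fun setT (fun s => u s i 0)) ->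
  measurable_fun setT (fun s => sqnorm (u s)).
Proof.
move=> mu; under eq_fun do rewrite sqnormE.
by apply: measurable_sum => i; exact: measurable_funX.
Qed.

Lemma measurable_mulmx_col (d : measure_display) (S : measurableType d) m n
    (M : 'M[R]_(m, n)) (u : S -> 'cV[R]_n) i :
  (forall i, measurable_fun setT (fun s => u s i 0)) ->
  measurable_fun setT (fun s => (M *m u s) i 0).
Proof.
move=> mu; under eq_fun do rewrite mxE.
by apply: measurable_sum => k; exact: measurable_funM.
Qed.

(** No sign is imposed on [x]: at 0 both sides follow the convention that the inverse of 0 is 0.
    This lets measurability in the variance be proved on the whole line. *)
Lemma mvnormal_pdf_scalar n (mu v : 'cV[R]_n) (x : R) :
  mvnormal_pdf mu x%:M v =
  expR (- (x^-1 * sqnorm (v - mu) / 2)) / Num.sqrt ((2 * pi) ^+ n * x ^+ n).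
Proof.
rewrite /mvnormal_pdf invmx_scalar det_scalar mul_mx_scalar -scalemxAl.
by rewrite mxE mulNr.
Qed.

Lemma mvnormal_pdf_ge0 n (mu v : 'cV[R]_n) (A : 'M[R]_n) :
  0 <= mvnormal_pdf mu A v.
Proof. by rewrite /mvnormal_pdf divr_ge0 ?expR_ge0 ?sqrtr_ge0. Qed.

Lemma mvnormal_pdf_scalar_gt0 n (mu v : 'cV[R]_n) (x : R) : 0 < x ->
  0 < mvnormal_pdf mu x%:M v.
Proof.
move=> x0; rewrite mvnormal_pdf_scalar divr_gt0 ?expR_gt0// sqrtr_gt0.
by rewrite mulr_gt0 ?exprn_gt0 ?mulr_gt0 ?pi_gt0.
Qed.

Lemma mvnormal_pdf_scalar_le n (mu v : 'cV[R]_n) (x : R) : 0 < x ->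
  mvnormal_pdf mu x%:M v <= (Num.sqrt ((2 * pi) ^+ n * x ^+ n))^-1.
Proof.
move=> x0; rewrite mvnormal_pdf_scalar ler_piMl ?invr_ge0 ?sqrtr_ge0//.
by rewrite -[leRHS]expR0 ler_expR oppr_le0 !mulr_ge0 ?invr_ge0 ?sqnorm_ge0// ltW.
Qed.

(** Writing the inverse as [x * (x ^+ 2)^-1] leaves a real power of a nonnegative base, and stays
    correct at 0 and for negative [x]. *)
Lemma measurable_inv : measurable_fun setT (fun x : R => x^-1).
Proof.
rewrite (_ : (fun x => _) = fun x : R => x * (x ^+ 2) `^ (-1)); last first.
  apply/funext => x; rewrite powR_inv1 ?sqr_ge0// expr2 invfM mulrA.
  by have [->|x0] := eqVneq x 0; rewrite ?invr0 ?mulr0// divff// mul1r.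
apply: measurable_funM => //.
exact: measurableT_comp (measurable_powR _) _.
Qed.

Lemma measurable_mvnormal_pdf_scalar (d : measure_display)
    (S : measurableType d) n (mu : S -> 'cV[R]_n) (x : S -> R) (v : S -> 'cV[R]_n) :
  (forall i, measurable_fun setT (fun s => mu s i 0)) ->
  measurable_fun setT x ->
  (forall i, measurable_fun setT (fun s => v s i 0)) ->
  measurable_fun setT (fun s => mvnormal_pdf (mu s) (x s)%:M (v s)).
Proof.
move=> mmu mx mv; under eq_fun do rewrite mvnormal_pdf_scalar.
have minv (f : S -> R) : measurable_fun setT f ->
    measurable_fun setT (fun s => (f s)^-1).
  exact: measurableT_comp measurable_inv.
apply: measurable_funM.
  apply: measurableT_comp => //; apply: measurableT_comp => //.
  apply: measurable_funM => //; apply: measurable_funM; first exact: minv.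
  apply: measurable_sqnorm => i; under eq_fun do rewrite !mxE.
  exact: measurable_funB.
apply: minv; apply: measurableT_comp.
  by apply: continuous_measurable_fun => y; exact: sqrt_continuous.
by apply: measurable_funM => //; exact: measurable_funX.
Qed.

Lemma sqrtr_exprn (x : R) n : 0 <= x -> Num.sqrt (x ^+ n) = Num.sqrt x ^+ n.
Proof.
move=> x0; elim: n => [|n IH]; first by rewrite !expr0 sqrtr1.
by rewrite !exprS sqrtrM// IH.
Qed.

Lemma powR_half_nat (x : R) n : 0 <= x ->
  x `^ (- (n%:R / 2)) = (Num.sqrt x ^+ n)^-1.
Proof.
by move=> x0; rewrite powRN [_ / 2]mulrC powRrM powR12_sqrt// powR_mulrn ?sqrtr_ge0.
Qed.

(** Up to its peak value, the integrand is the centred normal density with standard deviation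
    [s]. *)
Lemma integral_gauss_quadratic_lty (g : R) : 0 < g ->
  (\int[lebesgue_measure]_x (expR (- (g * x ^+ 2 / 2)))%:E < +oo)%E.
Proof.
move=> g0; pose s := (Num.sqrt g)^-1.
have s0 : s != 0 by rewrite invr_eq0 gt_eqF// sqrtr_gt0.
have peak0 := normal_peak_gt0 s0.
have -> : (\int[lebesgue_measure]_x (expR (- (g * x ^+ 2 / 2)))%:E =
    (normal_peak s)^-1%:E * \int[lebesgue_measure]_x (normal_pdf 0 s x)%:E)%E.
  rewrite -ge0_integralZl//; first last.
  - by rewrite lee_fin invr_ge0 ltW.
  - by move=> x _; rewrite lee_fin normal_pdf_ge0.
  - by apply/measurable_EFinP; exact: measurable_normal_pdf.
  apply: eq_integral => x _; rewrite -EFinM normal_pdfE// mulKf ?gt_eqF//.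
  rewrite /normal_fun subr0 /s exprVn sqr_sqrtr ?ltW//; congr (expR _)%:E.
  by field; rewrite gt_eqF.
by rewrite integral_normal_pdf mule1 ltry.
Qed.

Section ridge.
Variables (n p : nat) (M : 'M[R]_(n, p)) (v : 'cV[R]_n) (g : R).
Hypothesis g_gt0 : 0 < g.

(** Matrix and coefficients of ridge regression of [v] on [M] with penalty [g]. For
    [M := pa_cols e X j] and [v := col j X] they are [Tbar] and [Lhat]. *)
Let T := g%:M + M^T *m M.
Let L := invmx T *m (M^T *m v).

Let quad (u : 'cV[R]_p) : R := (u^T *m T *m u) 0 0.

Let quadE u : quad u = g * sqnorm u + sqnorm (M *m u).
Proof.
rewrite /quad /T mulmxDr mulmxDl mul_mx_scalar -scalemxAl mxE mxE.
by rewrite /sqnorm trmx_mul !mulmxA.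
Qed.

Let trT : T^T = T.
Proof. by rewrite /T linearD/= tr_scalar_mx trmx_mul trmxK. Qed.

(** The form [quad] is positive definite: already its part [g * sqnorm u] vanishes only at 0. *)
Lemma ridge_unitmx : T \in unitmx.
Proof.
rewrite -row_free_unit -kermx_eq0; apply/rowV0P => u /sub_kermxP uT.
have : quad u^T = 0 by rewrite /quad trmxK uT mul0mx mxE.
rewrite quadE => /eqP; rewrite paddr_eq0 ?mulr_ge0 ?sqnorm_ge0 ?ltW//.
rewrite mulf_eq0 gt_eqF//= => /andP[/eqP/sqnorm_eq0 u0 _].
by rewrite -[u]trmxK u0 trmx0.
Qed.

Let add00 (A B : 'M[R]_1) : (A + B) 0 0 = A 0 0 + B 0 0.
Proof. by rewrite mxE. Qed.

(** The mean of the model is [- (M *m l)], so the residual is [v + M *m l] and the square is centred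
    at [- L]. The normal equations [T *m L = M^T *m v] and their transpose account for the cross
    terms. *)
Lemma complete_square l :
  sqnorm (v + M *m l) + g * sqnorm l = quad (l + L) + (sqnorm v - quad L).
Proof.
have TL : T *m L = M^T *m v by rewrite mulKVmx// ridge_unitmx.
have LT : L^T *m T = v^T *m M by rewrite -[T]trT -trmx_mul TL trmx_mul trmxK.
have -> : quad (l + L) =
    quad l + (l^T *m (M^T *m v)) 0 0 + (v^T *m M *m l) 0 0 + quad L.
  have gen (A : 'M[R]_p) (b : 'cV[R]_p) : ((l + b)^T *m A *m (l + b)) 0 0 =
      (l^T *m A *m l) 0 0 + (l^T *m (A *m b)) 0 0 + (b^T *m A *m l) 0 0 +
      (b^T *m A *m b) 0 0.
    rewrite [(_ + _)^T]linearD/= !mulmxDl !mulmxDr !mulmxA !add00; ring.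
  by rewrite /quad gen TL LT.
rewrite quadE /sqnorm [(_ + _)^T]linearD/= trmx_mul !mulmxDl !mulmxDr !mulmxA.
rewrite !add00; ring.
Qed.

(** This Gaussian integral does not depend on the variance; only its positivity and finiteness
    matter. *)
Let K := (\int[lebesgue_tuple R p]_t (expR (- (quad (col_of_tuple t) / 2)))%:E)%E.

Let measurable_col i : measurable_fun setT (fun t : p.-tuple R => col_of_tuple t i 0).
Proof. by under eq_fun do rewrite mxE; exact: measurable_tnth. Qed.

Let measurable_quad :
  measurable_fun setT (fun t : p.-tuple R => expR (- (quad (col_of_tuple t) / 2))).
Proof.
under eq_fun do rewrite quadE.
apply: measurableT_comp => //; apply: measurableT_comp => //.
apply: measurable_funM => //; apply: measurable_funD.
  by apply: measurable_funM => //; exact: measurable_sqnorm.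
by apply: measurable_sqnorm => i; exact: measurable_mulmx_col.
Qed.

(** Since [quad u] is at least [g * sqnorm u], the integrand is dominated by a product of
    one-dimensional Gaussians. *)
Let K_lty : (K < +oo)%E.
Proof.
pose e (x : R) := expR (- (g * x ^+ 2 / 2)).
have me : measurable_fun setT e.
  apply: measurableT_comp => //; apply: measurableT_comp => //.
  apply: measurable_funM => //; apply: measurable_funM => //.
have e0 x : 0 <= e x by exact: expR_ge0.
apply: (@le_lt_trans _ _
    (\int[lebesgue_tuple R p]_t (\prod_(i < p) e (tnth t i))%:E)%E).
  apply: ge0_le_integral => //.
  - exact/measurable_EFinP.
  - apply/measurable_EFinP; apply: measurable_prod => i _.
    by apply: measurableT_comp => //; exact: measurable_tnth.
  - move=> t _; rewrite lee_fin /e -expR_sum ler_expR sumrN lerN2 quadE.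
    rewrite -mulr_suml ler_pM2r ?invr_gt0// sqnormE mulr_sumr.
    under [X in _ <= X + _]eq_bigr do rewrite mxE.
    by rewrite lerDl sqnorm_ge0.
rewrite (integral_lebesgue_tuple_prod p me e0).
have int_e_ge0 : (0 <= \int[lebesgue_measure]_x (e x)%:E)%E.
  by apply: integral_ge0 => x _; rewrite lee_fin.
rewrite -ge0_fin_numE; last by apply: prode_ge0.
by apply: prode_fin_num => i _; rewrite ge0_fin_numE//;
  exact: integral_gauss_quadratic_lty.
Qed.

Let K_gt0 : (0 < K)%E.
Proof.
apply: integral_gt0.
- exact/measurable_EFinP.
- by move=> t; rewrite lee_fin expR_ge0.
rewrite (_ : [set t | _] = setT) ?lebesgue_tuple_setT_gt0//.
by apply/seteqP; split => // t _ /=; rewrite lte_fin expR_gt0.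
Qed.

(* The substitution l = sqrt x u - L makes the quadratic part independent of x,
   so that its determinant is never computed. *)
Lemma integral_normal_ridge :
  exists2 c : R, 0 < c & forall x, 0 < x ->
    (\int[lebesgue_tuple R p]_t
      (mvnormal_pdf (- (M *m col_of_tuple t)) x%:M v *
       mvnormal_pdf 0 (g^-1 * x)%:M (col_of_tuple t))%:E =
     (c * (x `^ (- (n%:R / 2)) * expR (- ((sqnorm v - quad L) / 2) / x)))%:E)%E.
Proof.
have Kfin : K \is a fin_num by rewrite ge0_fin_numE// ltW.
have pi2 : 0 < 2 * pi :> R by rewrite mulr_gt0 ?pi_gt0.
pose A := Num.sqrt (2 * pi) ^+ n : R.
pose B := Num.sqrt (2 * pi) ^+ p * Num.sqrt g^-1 ^+ p : R.
have A0 : 0 < A by rewrite exprn_gt0// sqrtr_gt0.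
have B0 : 0 < B by rewrite mulr_gt0// exprn_gt0// sqrtr_gt0// invr_gt0.
exists (fine K / (A * B)).
  by apply: divr_gt0; [rewrite fine_gt0// K_gt0|exact: mulr_gt0].
move=> x x0; set s := Num.sqrt x.
have s0 : 0 < s by rewrite sqrtr_gt0.
have ss : s ^+ 2 = x by rewrite sqr_sqrtr// ltW.
pose D := (sqnorm v - quad L) / 2.
pose a : p.-tuple R := [tuple - L i 0 | i < p].
pose F (t : p.-tuple R) := mvnormal_pdf (- (M *m col_of_tuple t)) x%:M v *
       mvnormal_pdf 0 (g^-1 * x)%:M (col_of_tuple t).
(* The denominators [A * s ^+ n] and [B * s ^+ p] normalize the likelihood and the prior of the
   coefficients. The Jacobian [s ^+ p] of the substitution cancels the power in the second, so only
   [s ^- n], that is the power [- n / 2] of [x], survives. *)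
pose C := expR (- D / x) / (A * s ^+ n * (B * s ^+ p)).
have C0 : 0 <= C.
  by rewrite divr_ge0 ?expR_ge0// !mulr_ge0// ?exprn_ge0// ltW.
have mF : measurable_fun setT F.
  apply: measurable_funM; apply: measurable_mvnormal_pdf_scalar => // i.
    under eq_fun do rewrite mxE; apply: measurableT_comp => //.
    exact: measurable_mulmx_col.
have F_ge0 t : 0 <= F t by rewrite mulr_ge0// mvnormal_pdf_ge0.
have FE t : F (affine_tuple s a t) = C * expR (- (quad (col_of_tuple t) / 2)).
  pose l := col_of_tuple (affine_tuple s a t).
  have lE : l + L = s *: col_of_tuple t.
    apply/matrixP => i j; rewrite (ord1 j) mxE [l i 0]mxE !tnth_mktuple.
    by rewrite subrK [RHS]mxE [col_of_tuple t i 0]mxE.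
  rewrite /F -/l !mvnormal_pdf_scalar opprK subr0.
  rewrite mulf_div -expRD.
  have -> : - (x^-1 * sqnorm (v + M *m l) / 2) +
      - ((g^-1 * x)^-1 * sqnorm l / 2) =
      - D / x + - (quad (col_of_tuple t) / 2).
    transitivity (- (x^-1 * (sqnorm (v + M *m l) + g * sqnorm l) / 2)).
      by field; rewrite !gt_eqF.
    rewrite complete_square lE.
    have -> : quad (s *: col_of_tuple t) = x * quad (col_of_tuple t).
      by rewrite !quadE -scalemxAr !sqnormZ ss; ring.
    by rewrite /D; field; rewrite gt_eqF.
  rewrite expRD /C mulrAC; congr (_ / _ * _).
  have g'0 : 0 <= g^-1 by rewrite invr_ge0 ltW.
  have [pi2_ge0 x_ge0] := (ltW pi2, ltW x0).
  have gx0 : 0 <= g^-1 * x by rewrite mulr_ge0.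
  rewrite !(sqrtrM (_ ^+ _) (exprn_ge0 _ pi2_ge0)) !sqrtr_exprn//.
  rewrite (sqrtrM x g'0) exprMn.
  by rewrite /A /B /s; ring.
transitivity ((s ^+ p)%:E * (C%:E * K))%E.
  rewrite -[LHS]/(\int[lebesgue_tuple R p]_t (F t)%:E)%E.
  rewrite (integral_affine_tuple a s0)//; last exact/measurable_EFinP.
  congr (_ * _)%E; rewrite /K -ge0_integralZl//.
  - by apply: eq_integral => t _; rewrite FE EFinM.
  - exact/measurable_EFinP.
rewrite -(fineK Kfin) -!EFinM; congr (_%:E).
rewrite powR_half_nat ?ltW// /C -/s -/D; field.
by rewrite !gt_eqF// exprn_gt0.
Qed.

End ridge.
End gaussian.

(** * Inverse gamma kernels and the contribution of a node *)

Section inverse_gamma.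
Context (R : realType).
Implicit Types alpha beta x : R.

Lemma inv_gamma_fun_ge0 alpha beta x : 0 <= inv_gamma_fun alpha beta x.
Proof. by rewrite mulr_ge0 ?powR_ge0 ?expR_ge0. Qed.

Lemma measurable_inv_gamma_fun alpha beta :
  measurable_fun setT (inv_gamma_fun alpha beta).
Proof.
apply: measurable_funM; first exact: measurable_powR.
apply: measurableT_comp => //; apply: measurable_funM => //.
exact: measurable_inv.
Qed.

Lemma expR_ge_exprn (y : R) (n : nat) : 0 <= y -> y ^+ n.+1 / n.+1`!%:R <= expR y.
Proof.
by move=> y0; apply: le_trans (expR_ge1Dxn n y0); rewrite lerDr ler01.
Qed.

(** Near 0 the exponential beats the power. One term of the exponential series, of order
    [N.+1 > alpha + 1], bounds [expR (- beta / x)] by a multiple of [x ^+ N.+1], which absorbs the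
    power of [x] on the unit interval. *)
Lemma inv_gamma_fun_bounded01 alpha beta : 0 < beta ->
  exists C : R, forall x, 0 < x <= 1 -> inv_gamma_fun alpha beta x <= C.
Proof.
move=> b0; pose N := Num.truncn (alpha + 1).
exists (N.+1`!%:R / beta ^+ N.+1) => x /andP[x0 x1].
have y0 : 0 < x^-1 by rewrite invr_gt0.
have y1 : 1 <= x^-1 by rewrite invf_ge1.
have le1 : x `^ (- alpha - 1) <= x^-1 ^+ N.+1.
  rewrite exprVn -(powR_mulrn _ (ltW x0)) -powRN; apply: ger_powR.
    by rewrite x0.
  by rewrite -opprD lerN2 ltW// truncnS_gt.
have le2 : expR (- beta / x) <= N.+1`!%:R / (beta / x) ^+ N.+1.
  rewrite mulNr expRN -[leRHS]invrK lef_pV2 ?posrE ?expR_gt0//; last first.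
    by rewrite invr_gt0 divr_gt0 ?exprn_gt0 ?divr_gt0// ltr0n fact_gt0.
  by rewrite invf_div expR_ge_exprn// divr_ge0// ltW.
rewrite (le_trans (ler_pM _ _ le1 le2)) ?powR_ge0 ?expR_ge0//.
by rewrite exprMn; rewrite le_eqVlt; apply/orP; left; apply/eqP; field;
  rewrite !gt_eqF// exprn_gt0.
Qed.

(** For [x > 1] a larger shape and a larger rate both decrease the kernel. On the unit interval a
    larger shape increases the power of [x], so boundedness is used there instead. *)
Lemma inv_gamma_fun_integral_lty alpha beta alpha' beta' :
  0 < beta -> alpha <= alpha' -> beta <= beta' ->
  (\int[lebesgue_measure]_(x in `]0%R, +oo[) (inv_gamma_fun alpha beta x)%:E
    < +oo)%E ->
  (\int[lebesgue_measure]_(x in `]0%R, +oo[) (inv_gamma_fun alpha' beta' x)%:E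
    < +oo)%E.
Proof.
move=> b0 aa' bb' foo.
have b'0 := lt_le_trans b0 bb'.
have [C HC] := @inv_gamma_fun_bounded01 alpha' beta' b'0.
have C0 : 0 <= C.
  by apply: le_trans (HC 1 _); rewrite ?inv_gamma_fun_ge0// ltr01 lexx.
have mE a b D :
    @measurable_fun _ _ (measurableTypeR R) _ D (fun x => (inv_gamma_fun a b x)%:E).
  by apply/measurable_funTS/measurable_EFinP; exact: measurable_inv_gamma_fun.
pose I01 : set R := `]0%R, 1%R]%classic.
have mI D :
    @measurable_fun _ _ (measurableTypeR R) _ D (fun x => (C * \1_I01 x)%:E).
  apply/measurable_funTS/measurable_EFinP/measurable_funM => //.
  by apply: measurable_indic; exact: measurable_itv.
have ge0 a b x : (0 <= (inv_gamma_fun a b x)%:E)%E.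
  by rewrite lee_fin inv_gamma_fun_ge0.
have I_ge0 x : (0 <= (C * \1_I01 x)%:E)%E by rewrite lee_fin mulr_ge0.
apply: (@le_lt_trans _ _ (\int[lebesgue_measure]_(x in `]0%R, +oo[)
   ((inv_gamma_fun alpha beta x)%:E + (C * \1_I01 x)%:E))%E).
  apply: ge0_le_integral => //.
  - exact: emeasurable_funD.
  - move=> x; rewrite /= in_itv/= andbT => x0.
    rewrite -EFinD lee_fin.
    have [x1|x1] := leP x 1.
      have xI : I01 x by rewrite /I01 /= in_itv/= x0.
      rewrite (_ : \1_I01 x = 1) ?mulr1; last by rewrite indicE mem_set.
      by rewrite (le_trans (HC x _)) ?x0// lerDr inv_gamma_fun_ge0.
    rewrite (le_trans _ (_ : inv_gamma_fun alpha beta x <= _))//; last first.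
      by rewrite lerDl mulr_ge0.
    apply: ler_pM; rewrite ?powR_ge0 ?expR_ge0//.
      by apply: ler_powR; [exact: ltW|rewrite lerD2r lerN2].
    by rewrite ler_expR ler_pM2r ?invr_gt0// lerN2.
rewrite ge0_integralD// lte_add_pinfty//.
under eq_integral do rewrite EFinM.
have mI01 : measurable I01 by exact: measurable_itv.
rewrite ge0_integralZl//; last first.
  by apply/measurable_funTS/measurable_EFinP; exact: measurable_indic.
rewrite integral_indic// lte_mul_pinfty//.
apply: (@le_lt_trans _ _ (lebesgue_measure I01)).
  by apply: le_measure; rewrite ?inE//; exact: measurableI.
by rewrite /I01 lebesgue_measure_itv/= lte_fin ltr01 oppr0 adde0 ltry.
Qed.

End inverse_gamma.

Section node.
Context (R : realType) (d : measure_display) (T : measurableType d).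
Context (P : probability T R) (n0 n1 p0 p1 : nat).
Variables (s : {RV P >-> R}) (L0 : {RV P >-> p0.-tuple R}).
Variables (L1 : {RV P >-> p1.-tuple R}).
Variables (M0 : 'M[R]_(n0, p0)) (M1 : 'M[R]_(n1, p1)).
Variables (v0 : 'cV[R]_n0) (v1 : 'cV[R]_n1) (g0 g1 alpha beta : R).
Hypotheses (g0_gt0 : 0 < g0) (g1_gt0 : 0 < g1) (beta_gt0 : 0 < beta).
Hypothesis law_s : forall A, measurable A ->
  distribution P s A = inv_gamma alpha beta A.
Hypothesis law_L : forall A B0 B1, measurable A -> measurable B0 ->
  measurable B1 ->
  (P (s @^-1` A `&` (L0 @^-1` B0 `&` L1 @^-1` B1)) =
   \int[P]_(t in s @^-1` A) (mvnormal 0 (g0^-1 * s t)%:M B0 *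
                             mvnormal 0 (g1^-1 * s t)%:M B1))%E.

Let I0y : set (measurableTypeR R) := `]0%R, +oo[%classic.
Let mI0y : measurable I0y. Proof. exact: measurable_itv. Qed.

Let Z := (\int[lebesgue_measure]_(x in I0y) (inv_gamma_fun alpha beta x)%:E)%E.

Let Z_ge0 : (0 <= Z)%E.
Proof. by apply: integral_ge0 => x _; rewrite lee_fin inv_gamma_fun_ge0. Qed.

(* The prior is a probability, so its normalizing constant is finite. *)
Let Z_fin_gt0 : exists2 z, 0 < z & Z = z%:E.
Proof.
have := probability_setT P.
rewrite -[setT]/(s @^-1` setT) -[P _]/(distribution P s setT) law_s//.
rewrite /inv_gamma setTI -/I0y -/Z.
case: Z Z_ge0 => [z| |] //=.
- rewrite lee_fin le_eqVlt => /predU1P[<-|z0 _]; last by exists z.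
  by rewrite mul0e => /eqP; rewrite eqe eq_sym oner_eq0.
- by rewrite invey mule0 => _ /eqP; rewrite eqe eq_sym oner_eq0.
Qed.

Let N0 (z : R * p0.-tuple R) :=
  mvnormal_pdf (- (M0 *m col_of_tuple z.2)) z.1%:M v0.
Let N1 (z : R * p1.-tuple R) :=
  mvnormal_pdf (- (M1 *m col_of_tuple z.2)) z.1%:M v1.
Let phi0 (z : R * p0.-tuple R) := mvnormal_pdf 0 (g0^-1 * z.1)%:M (col_of_tuple z.2).
Let phi1 (z : R * p1.-tuple R) := mvnormal_pdf 0 (g1^-1 * z.1)%:M (col_of_tuple z.2).

Let measurable_col p (i : 'I_p) :
  measurable_fun setT (fun z : R * p.-tuple R => col_of_tuple z.2 i 0).
Proof.
under eq_fun do rewrite mxE.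
exact: (measurableT_comp (measurable_tnth i) measurable_snd).
Qed.

Let measurable_N n p (M : 'M[R]_(n, p)) (v : 'cV_n) :
  measurable_fun setT (fun z : R * p.-tuple R =>
    mvnormal_pdf (- (M *m col_of_tuple z.2)) z.1%:M v).
Proof.
apply: measurable_mvnormal_pdf_scalar => // i.
under eq_fun do rewrite mxE; apply: measurableT_comp => //.
by apply: measurable_mulmx_col => k; exact: measurable_col.
Qed.

Let measurable_phi p (g : R) :
  measurable_fun setT (fun z : R * p.-tuple R =>
    mvnormal_pdf 0 (g^-1 * z.1)%:M (col_of_tuple z.2)).
Proof.
apply: measurable_mvnormal_pdf_scalar => // [|i]; last exact: measurable_col.
exact: measurable_funM.
Qed.

Definition node_likelihood (z : R * p0.-tuple R * p1.-tuple R) : R :=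
  N0 z.1 * N1 (z.1.1, z.2).

Lemma node_likelihood_ge0 z : 0 <= node_likelihood z.
Proof. by rewrite mulr_ge0 ?mvnormal_pdf_ge0. Qed.

Lemma measurable_node_likelihood : measurable_fun setT node_likelihood.
Proof.
apply: measurable_funM.
  exact: (measurableT_comp (measurable_N M0 v0) measurable_fst).
apply: (measurableT_comp (measurable_N M1 v1)
  (g := fun z : R * p0.-tuple R * p1.-tuple R => (z.1.1, z.2))).
apply: measurable_fun_pair => //.
exact: (measurableT_comp measurable_fst measurable_fst).
Qed.

(** The penalized residual sum of squares, which is [post_rate] without its summand [g]. *)
Let resid n p (M : 'M[R]_(n, p)) (v : 'cV_n) g : R :=
  let A := g%:M + M^T *m M in
  let l := invmx A *m (M^T *m v) in sqnorm v - (l^T *m A *m l) 0 0.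

(** Completing the square at the centre [l = - L] exhibits it as a sum of two nonnegative terms. *)
Let resid_ge0 n p (M : 'M[R]_(n, p)) (v : 'cV_n) g : 0 < g -> 0 <= resid M v g.
Proof.
move=> g_gt0.
have := complete_square M v g_gt0 (- (invmx (g%:M + M^T *m M) *m (M^T *m v))).
rewrite addNr.
have -> : ((0 : 'cV[R]_p)^T *m (g%:M + M^T *m M) *m (0 : 'cV[R]_p)) 0 0 = 0.
  by rewrite mulmx0 mxE.
rewrite add0r /resid => <-.
by rewrite addr_ge0 ?mulr_ge0 ?sqnorm_ge0// ltW.
Qed.

Let alpha' := alpha + n0%:R / 2 + n1%:R / 2.
Let beta' := beta + resid M0 v0 g0 / 2 + resid M1 v1 g1 / 2.

Lemma integral_node_likelihood : exists2 c, 0 < c & forall A, measurable A ->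
  (\int[P]_(t in s @^-1` A) (node_likelihood (s t, L0 t, L1 t))%:E =
   c%:E * \int[lebesgue_measure]_(x in A `&` `]0%R, +oo[)
            (inv_gamma_fun alpha' beta' x)%:E)%E.
Proof.
have [z z0 ZE] := Z_fin_gt0.
have [c0 c0_gt0 c0E] := integral_normal_ridge M0 v0 g0_gt0.
have [c1 c1_gt0 c1E] := integral_normal_ridge M1 v1 g1_gt0.
(* The normalization of the prior of the variance times the constants of the two Gaussian integrals;
   none depends on [A]. *)
exists (z^-1 * c0 * c1); first by rewrite !mulr_gt0 ?invr_gt0.
move=> A mA.
have ms : @measurable_fun _ _ T (measurableTypeR R) setT s := measurable_funP s.
pose s' : {RV P >-> measurableTypeR R} :=
  HB.pack (s : T -> measurableTypeR R) (isMeasurableFun.Build _ _ _ _ _ ms).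
pose w (x : measurableTypeR R) : R :=
  z^-1 * (inv_gamma_fun alpha beta x * \1_I0y x).
have w_ge0 x : 0 <= w x.
  apply: mulr_ge0; first by rewrite invr_ge0 ltW.
  by apply: mulr_ge0 => //; exact: inv_gamma_fun_ge0.
have mig a b : @measurable_fun _ _ (measurableTypeR R) _ setT (inv_gamma_fun a b).
  exact: measurable_inv_gamma_fun.
have mwI : @measurable_fun _ _ (measurableTypeR R) _ setT
    (fun x => inv_gamma_fun alpha beta x * \1_I0y x).
  by apply: measurable_funM; [exact: mig|apply: measurable_indic; exact: mI0y].
have mw : measurable_fun setT w by exact: measurable_funM.
have Hs (B : set (measurableTypeR R)) : measurable B ->
    P (s' @^-1` B) = (\int[lebesgue_measure]_(x in B) (w x)%:E)%E.
  move=> mB; rewrite -[LHS]/(distribution P s B) law_s// /inv_gamma -/I0y -/Z ZE.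
  under [RHS]eq_integral do rewrite EFinM.
  rewrite ge0_integralZl//; first last.
  - by rewrite lee_fin invr_ge0 ltW.
  - move=> x _; rewrite lee_fin; apply: mulr_ge0 => //.
    exact: inv_gamma_fun_ge0.
  - exact/measurable_funTS/measurable_EFinP.
  rewrite inver gt_eqF// muleC; congr (_ * _)%E.
  rewrite integral_mkcondr; apply: eq_integral => x _.
  by rewrite patchE indicE; case: ifP => _; rewrite ?mulr1 ?mulr0.
pose f (y : measurableTypeR R * p0.-tuple R * p1.-tuple R) : R :=
  node_likelihood y * \1_A y.1.1.
have mf : measurable_fun setT f.
  apply: measurable_funM; first exact: measurable_node_likelihood.
  apply: (measurableT_comp (measurable_indic mA)).
  exact: (measurableT_comp measurable_fst measurable_fst).
have f_ge0 y : 0 <= f y by rewrite mulr_ge0// node_likelihood_ge0.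
have phi0_ge0 y : 0 <= phi0 y by exact: mvnormal_pdf_ge0.
have phi1_ge0 y : 0 <= phi1 y by exact: mvnormal_pdf_ge0.
have mphi0 :
    @measurable_fun _ _ (measurableTypeR R * p0.-tuple R)%type _ setT phi0.
  exact: measurable_phi.
have mphi1 :
    @measurable_fun _ _ (measurableTypeR R * p1.-tuple R)%type _ setT phi1.
  exact: measurable_phi.
have := @integral_joint_law _ _ _ _ _ _ _ _ _ P s' L0 L1
  lebesgue_measure (lebesgue_tuple R p0) (lebesgue_tuple R p1) w phi0 phi1
  mw mphi0 mphi1 w_ge0 phi0_ge0 phi1_ge0 Hs
  law_L f mf f_ge0.
move=> E; rewrite [LHS]integral_patch_indic; apply: (eq_trans E) => {E}.
rewrite -/I0y integral_patch_indic -ge0_integralZl//; first last.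
- by rewrite lee_fin !mulr_ge0 ?invr_ge0// ltW.
- move=> x _; rewrite lee_fin; apply: mulr_ge0 => //.
  exact: inv_gamma_fun_ge0.
- apply/measurable_EFinP; apply: measurable_funM => //.
  by apply: measurable_indic; exact: measurableI.
apply: eq_integral => x _.
(* The Gaussian integral formula needs a positive variance. For [x <= 0] the prior density [w] and
   the indicator on the right both vanish. *)
have [x0|x0] := ltP 0 x; last first.
  have xI : (x \in I0y) = false.
    by apply/memNset; rewrite /I0y /= in_itv/= andbT; apply/negP; rewrite -leNgt.
  rewrite indicE in_setI xI andbF mulr0 mule0.
  rewrite integral0_eq// => y0 _; rewrite integral0_eq// => y1 _.
  by rewrite /w indicE xI !(mulr0, mul0r).
have xI : x \in I0y by apply/mem_set; rewrite /I0y /= in_itv/= x0.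
pose k : R := \1_A x * (z^-1 * inv_gamma_fun alpha beta x).
have k0 : 0 <= k.
  apply: mulr_ge0 => //; apply: mulr_ge0; first by rewrite invr_ge0 ltW.
  exact: inv_gamma_fun_ge0.
pose F0 y := N0 (x, y) * phi0 (x, y); pose F1 y := N1 (x, y) * phi1 (x, y).
have mF0 : measurable_fun setT F0.
  by apply: measurable_funM;
    apply: measurable_fun_pair2; [exact: measurable_N|exact: measurable_phi].
have mF1 : measurable_fun setT F1.
  by apply: measurable_funM;
    apply: measurable_fun_pair2; [exact: measurable_N|exact: measurable_phi].
have F0_ge0 y : 0 <= F0 y by rewrite mulr_ge0 ?mvnormal_pdf_ge0.
have F1_ge0 y : 0 <= F1 y by rewrite mulr_ge0 ?mvnormal_pdf_ge0.
transitivity (\int[lebesgue_tuple R p0]_y0 \int[lebesgue_tuple R p1]_y1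
    (k * F0 y0 * F1 y1)%:E)%E.
  apply: eq_integral => y0 _; apply: eq_integral => y1 _; congr (_%:E).
  rewrite /f /k /F0 /F1 /w /node_likelihood /= (_ : \1_I0y x = 1 :> R).
    by ring.
  by rewrite indicE xI.
rewrite (@ge0_integral_prod_pair _ _ _ _ _ (lebesgue_tuple R p0)
  (lebesgue_tuple R p1) (fun y => k * F0 y) F1)//; first last.
- by move=> y; rewrite mulr_ge0.
- exact: measurable_funM.
under eq_integral do rewrite EFinM.
rewrite ge0_integralZl//; first last.
- by move=> y _; rewrite lee_fin.
- exact/measurable_EFinP.
have -> := c0E x x0; have -> := c1E x x0.
rewrite -!EFinM; congr (_%:E).
have xE : inv_gamma_fun alpha' beta' x = inv_gamma_fun alpha beta x *
    (x `^ (- (n0%:R / 2)) * expR (- (resid M0 v0 g0 / 2) / x)) *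
    (x `^ (- (n1%:R / 2)) * expR (- (resid M1 v1 g1 / 2) / x)).
  rewrite /inv_gamma_fun.
  have -> : - alpha' - 1 = (- alpha - 1) + - (n0%:R / 2) + - (n1%:R / 2).
    by rewrite /alpha'; ring.
  have -> : - beta' / x = - beta / x + - (resid M0 v0 g0 / 2) / x +
      - (resid M1 v1 g1 / 2) / x.
    by rewrite /beta'; ring.
  rewrite !expRD !powRD ?(gt_eqF x0) ?implybT//; ring.
rewrite (_ : \1_(A `&` I0y) x = \1_A x :> R); last first.
  by rewrite !indicE in_setI xI andbT.
rewrite xE /k /resid; ring.
Qed.

(** The integral is a multiple of that of the posterior kernel, whose shape exceeds that of the
    prior by half the sample sizes and whose rate exceeds it by half the residuals, both
    nonnegative. *)
Lemma integral_node_likelihood_lty :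
  (\int[P]_t (node_likelihood (s t, L0 t, L1 t))%:E < +oo)%E.
Proof.
have [c c0 /(_ setT measurableT)] := integral_node_likelihood.
rewrite preimage_setT setTI => ->; rewrite lte_mul_pinfty ?lee_fin ?ltW//.
apply: (@inv_gamma_fun_integral_lty _ alpha beta) => //.
- by rewrite /alpha' -addrA lerDl addr_ge0 ?divr_ge0.
- by rewrite /beta' -addrA lerDl addr_ge0 ?divr_ge0 ?resid_ge0.
- by have [z _] := Z_fin_gt0; rewrite /Z => ->; rewrite ltry.
Qed.

(** Gaussian densities are strictly positive wherever the variance is, and under the inverse gamma
    prior this is an event of probability 1. *)
Lemma integral_node_likelihood_gt0 :
  (0 < \int[P]_t (node_likelihood (s t, L0 t, L1 t))%:E)%E.
Proof.
apply: integral_gt0.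
- apply/measurable_EFinP; apply: (measurableT_comp measurable_node_likelihood).
  by do 2?apply: measurable_fun_pair.
- by move=> t; rewrite lee_fin node_likelihood_ge0.
have [z z0 ZE] := Z_fin_gt0.
have Ps : P (s @^-1` `]0%R, +oo[) = 1%E.
  rewrite -[LHS]/(distribution P s `]0%R, +oo[%classic) law_s//.
  by rewrite /inv_gamma setIid -/I0y -/Z ZE inver gt_eqF// -EFinM divff// gt_eqF.
apply: (@lt_le_trans _ _ 1%E); first by rewrite lte_fin.
rewrite -Ps le_measure ?inE//.
- by rewrite -[X in measurable X]setTI; exact: measurable_funP.
- rewrite -[X in measurable X]setTI; apply: emeasurable_fun_o_infty => //.
  apply/measurable_EFinP; apply: (measurableT_comp measurable_node_likelihood).
  by do 2?apply: measurable_fun_pair.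
- move=> t /=; rewrite in_itv/= andbT => st0.
  by rewrite lte_fin mulr_gt0// mvnormal_pdf_scalar_gt0.
Qed.

End node.

(** * Factorization over the nodes and Bayes' formula *)

Lemma prode_ord2 (R : realType) (F : 'I_2 -> \bar R) :
  (\prod_(k < 2) F k = F 0%R * F 1%R)%E.
Proof.
rewrite !big_ord_recl big_ord0 mule1.
by congr (F _ * F _)%E; exact: val_inj.
Qed.

Lemma prodr_ord2 (R : realType) (F : 'I_2 -> R) : \prod_(k < 2) F k = F 0 * F 1.
Proof.
by rewrite !big_ord_recl big_ord0 mulr1; congr (F _ * F _); exact: val_inj.
Qed.

Lemma sumr_ord2 (R : realType) (F : 'I_2 -> R) : \sum_(k < 2) F k = F 0 + F 1.
Proof.
by rewrite !big_ord_recl big_ord0 addr0; congr (F _ + F _); exact: val_inj.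
Qed.

Lemma ratio_scale (R : realType) (k : R) (a b : \bar R) : 0 < k ->
  (0 < b -> b < +oo -> (k%:E * a) / (k%:E * b) = a / b)%E.
Proof.
move=> k0; case: b => // b; rewrite lte_fin => b0 _.
rewrite -EFinM !inver !gt_eqF ?mulr_gt0// [(_ * a)%E]muleC -muleA -EFinM.
by congr (_ * _%:E)%E; field; rewrite !gt_eqF.
Qed.

Section posterior_dag.
Context (R : realType) (q : nat) (D : 'I_2 -> rel 'I_q) (n : 'I_2 -> nat).
Context (X : forall k : 'I_2, 'M[R]_(n k, q)) (g : 'I_2 -> R).
Hypothesis g_gt0 : forall k, 0 < g k.
Context (a : R) (d : measure_display) (T : measurableType d).
Context (P : probability T R) (sigma2 : 'I_q -> {RV P >-> R}).
Variable L : forall (k : 'I_2) (j : 'I_q), {RV P >-> #|pa (D k) j|.-tuple R}.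
Hypothesis prior : is_prior sigma2 L a g.

Let h (j : 'I_q) : R * #|pa (D 0) j|.-tuple R * #|pa (D 1) j|.-tuple R -> R :=
  node_likelihood (pa_cols (D 0) (X 0) j) (pa_cols (D 1) (X 1) j)
    (col j (X 0)) (col j (X 1)).

Let likE w : likelihood X (fun i => sigma2 i w) (fun k i => L k i w) =
  \prod_j h (node_block sigma2 L j w).
Proof.
rewrite /likelihood exchange_big; apply: eq_bigr => j _.
by rewrite prodr_ord2.
Qed.

Let prior_L2 j A B0 B1 : measurable A -> measurable B0 -> measurable B1 ->
  (P (sigma2 j @^-1` A `&` (L 0%R j @^-1` B0 `&` L 1%R j @^-1` B1)) =
   \int[P]_(w in sigma2 j @^-1` A)
     (mvnormal 0 ((g 0%R)^-1 * sigma2 j w)%:M B0 *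
      mvnormal 0 ((g 1%R)^-1 * sigma2 j w)%:M B1))%E.
Proof.
move=> mA mB0 mB1.
pose BT (k : 'I_2) := set (#|pa (D k) j|.-tuple R).
(* The type of the sets depends on the group, so the family with values [B0] and [B1] is obtained by
   overriding a constant family at 0 and at 1. *)
pose B : forall k, BT k :=
  @dfwith _ BT (@dfwith _ BT (fun=> setT) 0 B0) 1 B1.
have BE0 : B 0 = B0 by rewrite /B dfwithout// dfwithin.
have BE1 : B 1 = B1 by rewrite /B dfwithin.
have k01 (k : 'I_2) : k = 0 \/ k = 1.
  by case: k => -[|[|//]] ?; [left|right]; exact: val_inj.
have mB k : measurable (B k) by have [->|->] := k01 k; rewrite ?BE0 ?BE1.
have := prior_L prior mA mB.
rewrite (_ : \bigcap_k _ = L 0 j @^-1` B0 `&` L 1 j @^-1` B1); last first.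
  apply/seteqP; split => [w Bw|w [w0 w1] k _].
    by split; [have := Bw 0 I; rewrite BE0|have := Bw 1 I; rewrite BE1].
  by have [->|->] := k01 k; rewrite ?BE0 ?BE1.
by move=> ->; apply: eq_integral => w _; rewrite prode_ord2 BE0 BE1.
Qed.

Let law_sigma2 (j : 'I_q) : (0 < j)%N -> forall A, measurable A ->
  distribution P (sigma2 j) A =
  inv_gamma ((\sum_(k < 2) prior_shape a D k j) / 2) ((\sum_(k < 2) g k) / 2) A.
Proof. by move=> j0 A mA; exact: (prior_sigma2 prior). Qed.

Let rate_gt0 : 0 < (\sum_(k < 2) g k) / 2.
Proof. by rewrite sumr_ord2 divr_gt0 ?addr_gt0. Qed.

Let E j := (\int[P]_w (h (node_block sigma2 L j w))%:E)%E.

Let mblock j : measurable_fun setT (node_block sigma2 L j).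
Proof. by do 2?apply: measurable_fun_pair. Qed.

Let mh j : measurable_fun setT (h (j := j)).
Proof. exact: measurable_node_likelihood. Qed.

Let mh_block j : measurable_fun setT (fun w => h (node_block sigma2 L j w)).
Proof. exact: (measurableT_comp (@mh j) (@mblock j)). Qed.

Let h_ge0 j z : 0 <= h (j := j) z.
Proof. exact: node_likelihood_ge0. Qed.

Let E_ge0 j : (0 <= E j)%E.
Proof. by apply: integral_ge0 => w _; rewrite lee_fin. Qed.

(** The first node is treated apart: its variance is identically 1, so its likelihood is positive at
    every sample point. *)
Let E_gt0 j : (0 < E j)%E.
Proof.
have [j0|j0] := posnP j.
  apply: integral_gt0.
  - by apply/measurable_EFinP; exact: mh_block.
  - by move=> w; rewrite lee_fin.
  - rewrite (_ : [set w | _] = setT).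
      apply: (@lt_le_trans _ _ 1%E); first by rewrite lte_fin.
      by rewrite -(probability_setT P).
    apply/seteqP; split => // w _ /=; rewrite lte_fin mulr_gt0//
      mvnormal_pdf_scalar_gt0//= (prior_sigma2_first prior)//.
exact: (integral_node_likelihood_gt0 _ _ _ _ _ _ (law_sigma2 j0)).
Qed.

Let E_lty j : (E j < +oo)%E.
Proof.
have [j0|j0] := posnP j.
  (* The peak of a Gaussian density with variance 1: it bounds the likelihood of the first node
     uniformly in the coefficients. *)
  pose C n := (Num.sqrt ((2 * pi) ^+ n * 1 ^+ n))^-1 : R.
  apply: (@le_lt_trans _ _ (\int[P]_w (C (n 0%R) * C (n 1%R))%:E)%E).
    apply: ge0_le_integral => //.
    - by move=> w _; rewrite lee_fin.
    - by apply/measurable_EFinP; exact: mh_block.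
    - move=> w _; rewrite lee_fin /h /node_likelihood/= (prior_sigma2_first prior)//.
      by rewrite ler_pM ?mvnormal_pdf_ge0 ?mvnormal_pdf_scalar_le.
  rewrite integral_cst//; apply: lte_mul_pinfty => //.
    by rewrite lee_fin mulr_ge0 ?invr_ge0 ?sqrtr_ge0.
  exact: le_lt_trans (probability_le1 P measurableT) (ltry _).
exact: (integral_node_likelihood_lty _ _ _ _ (g_gt0 0) (g_gt0 1) rate_gt0
  (law_sigma2 j0) (@prior_L2 j)).
Qed.

Let integral_lik j A : measurable A ->
  (\int[P]_(w in sigma2 j @^-1` A)
     (likelihood X (fun i => sigma2 i w) (fun k i => L k i w))%:E =
   \int[P]_(w in sigma2 j @^-1` A) (h (node_block sigma2 L j w))%:E *
   \prod_(i | i != j) E i)%E.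
Proof.
(* The event on [sigma2 j] is moved into the factor of node [j], so that the restricted integral is
   still that of a product over independent blocks. *)
move=> mA; pose F i z := h (j := i) z * (if i == j then \1_A z.1.1 else 1).
have F_ge0 i z : 0 <= F i z by rewrite mulr_ge0//; case: ifP.
have mF i : measurable_fun setT (F i).
  apply: measurable_funM; first exact: measurable_node_likelihood.
  case: (i == j) => //.
  apply: (measurableT_comp (measurable_indic mA)).
  exact: (measurableT_comp measurable_fst measurable_fst).
have FE i : i != j -> F i = h (j := i).
  by move=> /negPf ij; apply/funext => z; rewrite /F ij mulr1.
have Foo i : (\int[P]_w (F i (node_block sigma2 L i w))%:E < +oo)%E.
  apply: le_lt_trans (E_lty i); apply: ge0_le_integral => //.
  - by move=> w _; rewrite lee_fin.
  - apply/measurable_EFinP; exact: (measurableT_comp (mF i) (@mblock i)).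
  - by apply/measurable_EFinP; exact: mh_block.
  - move=> w _; rewrite lee_fin /F /= ler_piMr//.
    by case: (i == j) => //; rewrite indicE; case: (_ \in _).
have := independent_integral_prod (prior_independent prior) mF F_ge0 Foo.
rewrite [X in _ = X -> _](bigD1 j)//= => IF.
rewrite [LHS]integral_patch_indic.
transitivity (\int[P]_w (\prod_i F i (node_block sigma2 L i w))%:E)%E.
  apply: eq_integral => w _; rewrite likE; congr (_%:E).
  rewrite (bigD1 j)//= [RHS](bigD1 j)//= /F eqxx mulrAC; congr (_ * _).
  by apply: eq_bigr => i /negPf ->; rewrite mulr1.
apply: (eq_trans IF); congr (_ * _)%E.
  rewrite [RHS]integral_patch_indic; apply: eq_integral => w _.
  by rewrite /F eqxx.
by apply: eq_bigr => i /FE ->.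
Qed.

Lemma posterior_sigma2 (j : 'I_q) (A : set R) : (0 < j)%N -> measurable A ->
  posterior P (fun w => likelihood X (fun i => sigma2 i w) (fun k i => L k i w))
    (sigma2 j) A =
  inv_gamma
    ((prior_shape a D 0 j + (n 0)%:R) / 2 + (prior_shape a D 1 j + (n 1)%:R) / 2)
    (post_rate (D 0) (X 0) (g 0) j / 2 + post_rate (D 1) (X 1) (g 1) j / 2) A.
Proof.
move=> j0 mA.
have [c c0 cE] := integral_node_likelihood (pa_cols (D 0) (X 0) j)
  (pa_cols (D 1) (X 1) j) (col j (X 0)) (col j (X 1)) (g_gt0 0) (g_gt0 1)
  (law_sigma2 j0) (@prior_L2 j).
have E_fin i : E i \is a fin_num by rewrite ge0_fin_numE.
pose C := \prod_(i | i != j) fine (E i).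
have C0 : 0 < C by apply: prodr_gt0 => i _; rewrite fine_gt0// E_gt0 E_lty.
have CE : (\prod_(i | i != j) E i = C%:E)%E.
  by rewrite -prodEFin; apply: eq_bigr => i _; rewrite fineK.
pose al :=
  (prior_shape a D 0 j + (n 0)%:R) / 2 + (prior_shape a D 1 j + (n 1)%:R) / 2.
pose be :=
  post_rate (D 0) (X 0) (g 0) j / 2 + post_rate (D 1) (X 1) (g 1) j / 2.
pose J B := (\int[lebesgue_measure]_(x in B `&` `]0%R, +oo[)
  (inv_gamma_fun al be x)%:E)%E.
have JE B : measurable B -> (\int[P]_(w in sigma2 j @^-1` B)
     (h (node_block sigma2 L j w))%:E = c%:E * J B)%E.
  move=> mB; apply: (eq_trans (cE B mB)).
  rewrite /J; apply: (congr1 (fun y => c%:E * y)%E).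
  apply: eq_integral => x _; congr (inv_gamma_fun _ _ _)%:E.
    by rewrite sumr_ord2 /al; field.
  by rewrite sumr_ord2 /be /post_rate /sqnorm /Tbar /Lhat; field.
(* This transfers positivity and finiteness from the node integral [E j] to the total mass of the
   posterior kernel. *)
have JT : (c%:E * J setT = E j)%E by rewrite -JE// preimage_setT.
have likJ B : measurable B -> (\int[P]_(w in sigma2 j @^-1` B)
     (likelihood X (fun i => sigma2 i w) (fun k i => L k i w))%:E =
   (C * c)%:E * J B)%E.
  by move=> mB; rewrite integral_lik// CE JE// muleC muleA EFinM.
(* The evidence is the case [B := setT] of [likJ]. Numerator and evidence share the factor [C * c],
   and the remaining quotient of kernel integrals is [inv_gamma] by definition. *)
rewrite /posterior likJ// -(preimage_setT (sigma2 j)) likJ//.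
rewrite ratio_scale ?mulr_gt0//; first by rewrite /inv_gamma /J setTI.
- by have := E_gt0 j; rewrite -JT pmule_rgt0 ?lte_fin.
- have := E_lty j; rewrite -JT; case: (J setT) => [r _| |//].
    by rewrite ltry.
  by rewrite gt0_muley ?lte_fin.
Qed.

End posterior_dag.

Unset Implicit Arguments.
Set Strict Implicit.
Set Printing Implicit Defensive.

Theorem mainTheorem4
  (R : realType) (q : nat)
  (D : 'I_2 -> rel 'I_q) (D_dag : forall k, is_dag (D k))
  (n : 'I_2 -> nat) (X : forall k : 'I_2, 'M[R]_(n k, q))
  (g : 'I_2 -> R) (g_gt0 : forall k, 0 < g k)
  (a : R) (a_gt : q%:R - 1 < a)
  (d : measure_display) (T : measurableType d) (P : probability T R)
  (sigma2 : 'I_q -> {RV P >-> R})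
  (L : forall (k : 'I_2) (j : 'I_q), {RV P >-> #|pa (D k) j|.-tuple R})
  (prior : is_prior sigma2 L a g)
  (j : 'I_q) (j_gt0 : (0 < j)%N)
  (A : set R) (mA : measurable A) :
  let lik (w : T) := likelihood X (fun i => sigma2 i w) (fun k i => L k i w) in
  let alpha (k : 'I_2) := prior_shape a D k j + (n k)%:R in
  let beta (k : 'I_2) := post_rate (D k) (X k) (g k) j in
  posterior P lik (sigma2 j) A =
  inv_gamma (alpha 0 / 2 + alpha 1 / 2) (beta 0 / 2 + beta 1 / 2) A.
Proof.
by move=> lik alpha beta; exact: (posterior_sigma2 X g_gt0 prior j_gt0 mA).
Qed.
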